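(* Let $n\geq 2$, let $K$ be a field, let $L_1,\dots,L_n$ be field extensions of $K$, and let $t_i=\operatorname{tr\,deg}_K L_i$ for $i=1,\dots,n$. Assume $t_1\leq t_2\leq\cdots\leq t_{n-1}\leq t_n$. If $t_{n-1}<\infty$, then $$\dim(L_1\otimes_K\cdots\otimes_K L_n)=t_1+t_2+\cdots+t_{n-1};$$ otherwise $$\dim(L_1\otimes_K\cdots\otimes_K L_n)=\infty.$$
   Context: $\dim$ denotes the Krull dimension of a ring. $\operatorname{tr\,deg}_K L$ denotes the transcendence degree of a field extension $L/K$, which may be infinite (all infinite transcendence degrees are recorded as $\infty$). *)

(* Defs.v *)
From HB Require Import structures.
From mathcomp Require Import all_boot all_order all_algebra.
From mathcomp Require Import freeg.
From mathcomp Require mpoly boolp classical_sets constructive_ereal.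

Set Implicit Arguments.
Unset Strict Implicit.
Unset Printing Implicit Defensive.

Import GRing.Theory.
Local Open Scope ring_scope.

Section AlgebraicIndependence.
(* The notations of mpoly clash with those of classical_sets: the import has to
   stay inside this section. *)
Import mpoly.
Variables (K L : fieldType) (f : {rmorphism K -> L}).

Definition alg_independent (m : nat) (x : 'I_m -> L) : Prop :=
  forall p : {mpoly K[m]}, mmap f x p = 0 -> p = 0.

End AlgebraicIndependence.

Import boolp classical_sets constructive_ereal.
Local Open Scope classical_set_scope.

(* Supremum, in the extended integers, of a set of natural numbers: +oo when
   the set is unbounded, -oo when it is empty. *)
Definition nat_sup (N : set nat) : \bar int :=
  supremum -oo%E [set n%:Z%:E%E | n in N].

Section KrullDimension.
Variable A : comPzRingType.

(* ring_quotient.prime_idealr_closed and idealr_closed are only available on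
   nonzero rings, and for boolean predicates. *)
Definition prime_ideal (P : set A) : Prop :=
  [/\ P 0, forall x y, P x -> P y -> P (x + y), forall a x, P x -> P (a * x),
      ~ P 1 & forall x y, P (x * y) -> P x \/ P y].

(* P 0 `<` P 1 `<` ... `<` P d; the values of P beyond d are irrelevant. *)
Definition has_prime_chain (d : nat) : Prop :=
  exists P : nat -> set A,
    (forall i, (i <= d)%N -> prime_ideal (P i)) /\
    (forall i, (i < d)%N -> P i `<` P i.+1).

Definition krull_dim : \bar int := nat_sup [set d | has_prime_chain d].

End KrullDimension.

Section TranscendenceDegree.
Variables (K L : fieldType) (f : {rmorphism K -> L}).

(* The largest number of elements of L that are algebraically independent over
   K, all infinite values being identified with +oo. *)
Definition trdeg : \bar int :=
  nat_sup [set m | exists x : 'I_m -> L, alg_independent f x].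

End TranscendenceDegree.

(* The tensor product over R of a finite family of commutative R-algebras A i
   with structure morphisms f i: the free R-module on the families of elements
   of the A i, modulo the submodule generated by the multilinearity relations,
   with the product induced by the componentwise product of families. *)
Section TensorProduct.
Local Open Scope quotient_scope.
Variables (I : finType) (R : comNzRingType) (A : I -> comPzRingType).
Variable f : forall i, {rmorphism R -> A i}.

Definition family := forall i, A i.
HB.instance Definition _ := Choice.on family.
Implicit Types x y z : family.

Definition family_one : family := fun i => 1.
Definition family_mul x y : family := fun i => x i * y i.

Lemma family_mulA : associative family_mul.
Proof. by move=> x y z; apply: functional_extensionality_dep => i; apply: mulrA. Qed.

Lemma family_mulC : commutative family_mul.
Proof. by move=> x y; apply: functional_extensionality_dep => i; apply: mulrC. Qed.

Lemma family_mul1 : left_id family_one family_mul.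
Proof. by move=> x; apply: functional_extensionality_dep => i; apply: mul1r. Qed.

Lemma family_mul_dfwith x y i (a : A i) :
  family_mul (dfwith x a) y = dfwith (family_mul x y) (a * y i).
Proof.
apply: functional_extensionality_dep => j; rewrite /family_mul.
by have [<-|ij] := eqVneq i j; rewrite ?dfwith_in ?dfwith_out.
Qed.

Definition free_module := {freeg family / R}.
HB.instance Definition _ := GRing.Lmodule.on free_module.
Implicit Types u v w : free_module.

Definition gen x : free_module := Freeg [:: (1, x)].

Lemma free_module_ind (P : free_module -> Prop) :
  P 0 -> (forall c x u, P u -> P (c *: gen x + u)) -> forall u, P u.
Proof.
move=> P0 PD; elim/freeg_ind_dom0 => // c x u _ _ /(PD c x).
suff -> : Freeg [:: (c, x)] = c *: gen x by [].
by apply/eqP/freeg_eqP => y; rewrite coeffZ !coeffU mul1r.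
Qed.

Section LinearExtension.
Variables (M : lmodType R) (h : family -> M).

Fact fglift_linear : linear (fglift h : free_module -> M).
Proof.
have liftD := lift_is_additive h.
have lift0 : fglift h 0 = 0 by rewrite -(subrr (0 : free_module)) liftD subrr.
have liftN u : fglift h (- u) = - fglift h u by rewrite -sub0r liftD lift0 sub0r.
have liftA u v : fglift h (u + v) = fglift h u + fglift h v.
  by rewrite -[v in LHS]opprK liftD liftN opprK.
move=> c u v; rewrite liftA; congr (_ + _).
have liftS d x : fglift h (d *: gen x) = d *: h x.
  suff -> : d *: gen x = Freeg [:: (d, x)] by rewrite liftU.
  by apply/eqP/freeg_eqP => y; rewrite coeffZ !coeffU mul1r.
elim/free_module_ind: u => [|d x u IHu]; first by rewrite !scaler0 lift0 scaler0.
by rewrite scalerDr !liftA scalerDr IHu scalerA !liftS scalerA.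
Qed.

HB.instance Definition _ :=
  GRing.isLinear.Build R free_module M _ (fglift h) fglift_linear.

Lemma fglift_gen x : fglift h (gen x) = h x.
Proof. by rewrite /gen liftU scale1r. Qed.

End LinearExtension.

Definition free_mul u v : free_module :=
  fglift (fun x => fglift (fun y => gen (family_mul x y)) v) u.

Lemma free_mul_gen x y : free_mul (gen x) (gen y) = gen (family_mul x y).
Proof. by rewrite /free_mul !fglift_gen. Qed.

Lemma free_mulDl u v w : free_mul (u + v) w = free_mul u w + free_mul v w.
Proof. exact: linearD. Qed.

Lemma free_mulZl c u v : free_mul (c *: u) v = c *: free_mul u v.
Proof. exact: linearZ. Qed.

Lemma free_mul0l v : free_mul 0 v = 0.
Proof. exact: linear0. Qed.

Lemma free_mul0r u : free_mul u 0 = 0.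
Proof.
elim/free_module_ind: u => [|c x u IHu]; first exact: free_mul0l.
by rewrite free_mulDl free_mulZl IHu /free_mul fglift_gen linear0 scaler0 addr0.
Qed.

Lemma free_mulDr u v w : free_mul u (v + w) = free_mul u v + free_mul u w.
Proof.
elim/free_module_ind: u => [|c x u IHu]; first by rewrite !free_mul0l addr0.
rewrite !free_mulDl !free_mulZl IHu addrACA -scalerDr.
by rewrite /free_mul !fglift_gen linearD.
Qed.

Lemma free_mulZr c u v : free_mul u (c *: v) = c *: free_mul u v.
Proof.
elim/free_module_ind: u => [|d x u IHu]; first by rewrite !free_mul0l scaler0.
rewrite !free_mulDl !free_mulZl IHu scalerDr !scalerA mulrC -scalerA.
by congr (_ + _); rewrite /free_mul !fglift_gen linearZ scalerA mulrC.
Qed.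

Definition free_mulE :=
  (free_mul0l, free_mul0r, free_mulDl, free_mulDr, free_mulZl, free_mulZr).

Lemma free_mulC : commutative free_mul.
Proof.
move=> u v; elim/free_module_ind: u => [|c x u IHu]; first by rewrite !free_mulE.
rewrite !free_mulE IHu; congr (_ *: _ + _) => {u IHu}.
elim/free_module_ind: v => [|d y v IHv]; first by rewrite !free_mulE.
by rewrite !free_mulE IHv !free_mul_gen family_mulC.
Qed.

Lemma free_mulA : associative free_mul.
Proof.
move=> u v w; elim/free_module_ind: u => [|c x u IHu]; first by rewrite !free_mulE.
rewrite !free_mulE IHu; congr (_ *: _ + _) => {u IHu}.
elim/free_module_ind: v => [|d y v IHv]; first by rewrite !free_mulE.
rewrite !free_mulE IHv; congr (_ *: _ + _) => {v IHv}.
elim/free_module_ind: w => [|e z w IHw]; first by rewrite !free_mulE.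
by rewrite !free_mulE IHw !free_mul_gen family_mulA.
Qed.

Lemma free_mul1 : left_id (gen family_one) free_mul.
Proof.
elim/free_module_ind => [|c x u IHu]; first by rewrite !free_mulE.
by rewrite !free_mulE IHu free_mul_gen family_mul1.
Qed.

Inductive tensor_rel : free_module -> Prop :=
| tensor_rel0 : tensor_rel 0
| tensor_relD u v : tensor_rel u -> tensor_rel v -> tensor_rel (u + v)
| tensor_relZ c u : tensor_rel u -> tensor_rel (c *: u)
| tensor_rel_add x i (a b : A i) :
    tensor_rel (gen (dfwith x (a + b)) - gen (dfwith x a) - gen (dfwith x b))
| tensor_rel_scale x i c (a : A i) :
    tensor_rel (gen (dfwith x (f i c * a)) - c *: gen (dfwith x a)).

Lemma tensor_relN u : tensor_rel u -> tensor_rel (- u).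
Proof. by rewrite -scaleN1r; apply: tensor_relZ. Qed.

Lemma tensor_relMl u v : tensor_rel u -> tensor_rel (free_mul u v).
Proof.
move=> ru; elim/free_module_ind: v => [|c y v IHv].
  by rewrite free_mulE; apply: tensor_rel0.
rewrite free_mulDr free_mulZr; apply: tensor_relD => //; apply: tensor_relZ.
elim: ru => {u v IHv} [|u v _ ru _ rv|d u _ ru|x i a b|x i d a].
- by rewrite free_mulE; apply: tensor_rel0.
- by rewrite free_mulE; apply: tensor_relD.
- by rewrite free_mulE; apply: tensor_relZ.
- rewrite -!scaleN1r !free_mulE !free_mul_gen !family_mul_dfwith mulrDl !scaleN1r.
  exact: tensor_rel_add.
- rewrite -!scaleN1r !free_mulE !free_mul_gen !family_mul_dfwith -mulrA !scaleN1r.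
  exact: tensor_rel_scale.
Qed.

Definition in_tensor_rel : {pred free_module} := fun u => `[< tensor_rel u >].

Fact in_tensor_rel_zmod_closed : zmod_closed in_tensor_rel.
Proof.
split=> [|u v /asboolP ru /asboolP rv]; apply/asboolP; first exact: tensor_rel0.
by apply: tensor_relD => //; apply: tensor_relN.
Qed.

HB.instance Definition _ := GRing.isZmodClosed.Build free_module in_tensor_rel
  in_tensor_rel_zmod_closed.

Definition tensor := Quotient.quot in_tensor_rel.
HB.instance Definition _ := GRing.Zmodule.on tensor.
HB.instance Definition _ := Quotient.on tensor.

Lemma tensor_eqP u v :
  \pi_tensor u = \pi_tensor v <-> tensor_rel (u - v).
Proof.
split=> [/eqP|r]; first by rewrite -Quotient.idealrBE => /asboolP.
by apply/eqP; rewrite -Quotient.idealrBE; apply/asboolP.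
Qed.

Variant tensor_spec : tensor -> Prop := TensorSpec u : tensor_spec (\pi_tensor u).

Lemma tensorP s : tensor_spec s.
Proof. by rewrite -[s]reprK. Qed.

Definition pure_tensor x : tensor := \pi_tensor (gen x).

Definition tensor_mul (s t : tensor) : tensor :=
  \pi_tensor (free_mul (repr s) (repr t)).

Lemma pi_tensor_mul u v :
  tensor_mul (\pi_tensor u) (\pi_tensor v) = \pi_tensor (free_mul u v).
Proof.
apply/tensor_eqP; set u' := repr _; set v' := repr _.
have ru : tensor_rel (u' - u) by apply/tensor_eqP; rewrite reprK.
have rv : tensor_rel (v' - v) by apply/tensor_eqP; rewrite reprK.
suff -> : free_mul u' v' - free_mul u v =
    free_mul (u' - u) v' + free_mul (v' - v) u.
  by apply: tensor_relD; apply: tensor_relMl.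
have free_mulBl a b c : free_mul (a - b) c = free_mul a c - free_mul b c.
  by rewrite -!scaleN1r !free_mulE.
by rewrite !free_mulBl (free_mulC v') (free_mulC v) addrA subrK.
Qed.

Lemma pi_tensorD u v : \pi_tensor (u + v) = \pi_tensor u + \pi_tensor v.
Proof. exact: Quotient.pi_add. Qed.

Fact tensor_mulA : associative tensor_mul.
Proof.
move=> s t r; case: (tensorP s) (tensorP t) (tensorP r) => u [v] [w].
by rewrite !pi_tensor_mul free_mulA.
Qed.

Fact tensor_mulC : commutative tensor_mul.
Proof. by move=> s t; case: (tensorP s) (tensorP t) => u [v]; rewrite !pi_tensor_mul free_mulC. Qed.

Fact tensor_mul1 : left_id (pure_tensor family_one) tensor_mul.
Proof. by move=> s; case: (tensorP s) => u; rewrite pi_tensor_mul free_mul1. Qed.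

Fact tensor_mulDl : left_distributive tensor_mul +%R.
Proof.
move=> s t r; case: (tensorP s) (tensorP t) (tensorP r) => u [v] [w].
by rewrite -pi_tensorD !pi_tensor_mul -pi_tensorD free_mulDl.
Qed.

HB.instance Definition _ := GRing.Zmodule_isComPzRing.Build tensor
  tensor_mulA tensor_mulC tensor_mul1 tensor_mulDl.

Lemma pure_tensorM x y :
  pure_tensor (family_mul x y) = pure_tensor x * pure_tensor y.
Proof. by rewrite [RHS]pi_tensor_mul free_mul_gen. Qed.

Lemma pure_tensorD x i (a b : A i) :
  pure_tensor (dfwith x (a + b)) =
  pure_tensor (dfwith x a) + pure_tensor (dfwith x b).
Proof.
rewrite -pi_tensorD; apply/tensor_eqP; rewrite opprD addrA.
exact: tensor_rel_add.
Qed.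

(* Universal property; uniqueness holds because the pure tensors span. *)
Lemma tensor_lift (M : lmodType R) (h : family -> M) :
  (forall x i (a b : A i),
     h (dfwith x (a + b)) = h (dfwith x a) + h (dfwith x b)) ->
  (forall x i c (a : A i), h (dfwith x (f i c * a)) = c *: h (dfwith x a)) ->
  exists g : tensor -> M, {morph g : s t / s + t} /\
    forall c x, g (\pi_tensor (c *: gen x)) = c *: h x.
Proof.
move=> hD hZ.
have liftD u v : fglift h (u + v) = fglift h u + fglift h v by exact: linearD.
have liftB u v : fglift h (u - v) = fglift h u - fglift h v by exact: linearB.
have liftZ c u : fglift h (c *: u) = c *: fglift h u by exact: linearZ.
have lift_rel u : tensor_rel u -> fglift h u = 0.
  elim=> {u} [|u v _ hu _ hv|c u _ hu|x i a b|x i c a].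
  - exact: linear0.
  - by rewrite liftD hu hv addr0.
  - by rewrite liftZ hu scaler0.
  - by rewrite !liftB !fglift_gen hD addrAC addrK subrr.
  - by rewrite liftB liftZ !fglift_gen hZ subrr.
have lift_pi u : fglift h (repr (\pi_tensor u)) = fglift h u.
  have /lift_rel : tensor_rel (repr (\pi_tensor u) - u).
    by apply/tensor_eqP; rewrite reprK.
  by rewrite liftB => /eqP; rewrite subr_eq0 => /eqP.
exists (fun t => fglift h (repr t)); split=> [s t|c x].
  case: (tensorP s) (tensorP t) => u [v].
  by rewrite -pi_tensorD !lift_pi liftD.
by rewrite lift_pi liftZ fglift_gen.
Qed.

End TensorProduct.

(* Main.v *)
(* Let M be the last field, let X_i be finite algebraically independent families
   in the other fields L_i, and let A be the tensor product.

   Upper bound: in the residue field of the first prime of a chain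
   P_0 < ... < P_d, elements q_j of P_(j+1) outside P_j are algebraically
   independent over M. If the X_i are maximal, everything is algebraic over M
   and the X_i, and Steinitz exchange bounds d.

   Lower bound: suppose that the ideals I_0 <= ... <= I_s and the elements
   u_0, ..., u_(s-1) of A are such that I_s is proper and u_k lies in I_(k+1)
   and is not a zero divisor modulo I_k. Going down from a prime over I_s yields
   a chain of primes of length s. Choose in M a family y_i that is independent
   over K and as long as X_i, and let the u_k be the differences X_ij - y_ij.
   Each L_i retracts K(X_i)-linearly onto K(X_i); multiplying these retractions
   together and replacing the first k variables by their y_ij gives an additive
   map phi_k from A to a field of rational functions over M, and I_k is the
   largest ideal on which phi_k vanishes. *)
From HB Require Import structures.
Require Import Defs.
From mathcomp Require Import all_boot all_order all_algebra.
From mathcomp Require Import generic_quotient ring_quotient fraction polyXY ring.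
From mathcomp Require mpoly boolp.

Set Implicit Arguments.
Unset Strict Implicit.
Unset Printing Implicit Defensive.

Import Order.TTheory GRing.Theory Num.Theory.
Local Open Scope ring_scope.

(** * Multivariate polynomials *)

Definition subring (E : fieldType) (R : E -> Prop) : Prop :=
  [/\ R 1, forall x y, R x -> R y -> R (x - y) & forall x y, R x -> R y -> R (x * y)].

Definition subfield (E : fieldType) (k : E -> Prop) : Prop :=
  subring k /\ forall x, k x -> k x^-1.

(* The numerators and the nonzero denominators specialize from each k to the
   next, so that the vanishing of e k propagates to e k.+1. *)
Definition coherent (W : idomainType) (spec : nat -> {rmorphism W -> W})
    (e : nat -> {fraction W}) : Prop :=
  exists P Q : nat -> W, forall k,
    [/\ Q k != 0, e k = tofrac (P k) / tofrac (Q k), spec k (P k) = P k.+1 &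
        spec k (Q k) = Q k.+1].

Section MultivariatePolynomials.
(* The notations of mpoly clash with those of classical_sets, imported below. *)
Import mpoly.

Lemma rmorph_mmap (n : nat) (R : nzRingType) (S T : nzRingType) (g : {rmorphism S -> T})
    (f : {rmorphism R -> S}) (h : 'I_n -> S) (p : {mpoly R[n]}) :
  g (mmap f h p) = mmap (g \o f) (g \o h) p.
Proof.
rewrite /mmap rmorph_sum; apply: eq_bigr => m _; rewrite rmorphM; congr (_ * _).
by rewrite /mmap1 rmorph_prod; apply: eq_bigr => i _; rewrite rmorphXn.
Qed.

Lemma eq_mmap (n : nat) (R S : nzRingType) (f f' : R -> S) (h h' : 'I_n -> S)
    (p : {mpoly R[n]}) :
  f =1 f' -> h =1 h' -> mmap f h p = mmap f' h' p.
Proof.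
move=> ff' hh'; rewrite /mmap; apply: eq_bigr => m _; rewrite ff'; congr (_ * _).
exact: mmap1_eq.
Qed.

Lemma mmap_closed (n : nat) (R S : nzRingType) (f : R -> S) (h : 'I_n -> S)
    (P : S -> Prop) (p : {mpoly R[n]}) :
    P 0 -> P 1 -> (forall x y, P x -> P y -> P (x + y)) ->
    (forall x y, P x -> P y -> P (x * y)) ->
    (forall c, P (f c)) -> (forall i, P (h i)) ->
  P (mmap f h p).
Proof.
move=> P0 P1 PD PM Pf Ph; rewrite /mmap; apply: (big_ind P) => // m _; apply: (PM) => //.
rewrite /mmap1; apply: (big_ind P) => // i _; elim: (m i) => [|k IHk]; first by rewrite expr0.
by rewrite exprS; apply: PM.
Qed.

Lemma mmap_id (n : nat) (R : nzRingType) (p : {mpoly R[n]}) :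
  mmap (@mpolyC n R) (fun i => 'X_i) p = p.
Proof.
rewrite /mmap [RHS]mpolyE; apply: eq_bigr => m _.
by rewrite mmap1_id mul_mpolyC.
Qed.

(** Renaming the variables along [s] turns a relation among [x \o s] into one among [x]. The
    renaming is injective on polynomials: sending ['X_(s j)] back to ['X_j] and every other variable
    to 0 undoes it. *)
Lemma alg_independent_sub (K L : fieldType) (f : {rmorphism K -> L}) (m m' : nat)
    (x : 'I_m -> L) (s : 'I_m' -> 'I_m) :
  injective s -> alg_independent f x -> alg_independent f (x \o s).
Proof.
move=> sinj xind p px.
pose q := mmap (@mpolyC m K) (fun j => 'X_(s j)) p.
have q0 : q = 0.
  apply: xind; rewrite /q rmorph_mmap -[RHS]px; apply: eq_mmap => [c|j] /=.
    by rewrite mmapC.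
  by rewrite mmapX mmap1U.
rewrite -[p]mmap_id -(rmorph0 (mmap (@mpolyC m' K)
  (fun i => if [pick j | s j == i] is Some j then 'X_j else 0))) -[in RHS]q0.
rewrite /q rmorph_mmap; apply: eq_mmap => [c|j] /=; first by rewrite mmapC.
rewrite mmapX mmap1U; case: pickP => [j' /eqP/sinj -> //|/(_ j)].
by rewrite eqxx.
Qed.

Lemma alg_independent0 (K L : fieldType) (f : {rmorphism K -> L}) (x : 'I_0 -> L) :
  alg_independent f x.
Proof.
move=> p; rewrite (nvar0_mpolyC p) mmapC => /eqP.
by rewrite fmorph_eq0 => /eqP ->; rewrite mpolyC0.
Qed.

Definition extend (T : Type) (m : nat) (x : 'I_m -> T) (l : T) (i : 'I_m.+1) : T :=
  if unlift ord_max i is Some j then x j else l.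

(** A nontrivial relation among [x] and [l] is read as a polynomial in the last variable over K[X].
    Evaluating its coefficients at [x] cannot kill it, since [x] is independent. *)
Lemma alg_independent_extend (K L : fieldType) (f : {rmorphism K -> L}) (m : nat)
    (x : 'I_m -> L) (l : L) :
    alg_independent f x -> ~ alg_independent f (extend x l) ->
  exists2 q : {poly L}, q != 0 /\ root q l &
    forall i, exists c : {mpoly K[m]}, q`_i = mmap f x c.
Proof.
move=> xind nind.
have [p pxl /eqP p0] : exists2 p, mmap f (extend x l) p = 0 & p <> 0.
  apply: boolp.contrapT => nop; apply: nind => p pxl.
  by apply: boolp.contrapT => p0; apply: nop; exists p.
pose h := extend (fun j => ('X_j)%:P) 'X : 'I_m.+1 -> {poly {mpoly K[m]}}.
pose q := mmap (polyC \o @mpolyC m K) h p; exists (map_poly (mmap f x) q); last first.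
  by move=> i; exists q`_i; rewrite coef_map.
have q0 : q != 0.
  apply: contra_neq p0 => q0.
  (* [g] followed by evaluation at the last variable recovers [p] from [q]. *)
  pose g := map_poly (mmap (@mpolyC m.+1 K) (fun j => 'X_(lift ord_max j))).
  have : (g q).['X_ord_max] = 0 by rewrite q0 /g rmorph0 horner0.
  rewrite -[_.[_]]/(horner_eval _ _) /g /q !rmorph_mmap => <-; rewrite -[LHS]mmap_id.
  apply: eq_mmap => [c|i] /=; first by rewrite map_polyC /= mmapC /horner_eval hornerC.
  rewrite /h /extend; case: unliftP => [j|] -> /=.
    by rewrite map_polyC /= mmapX mmap1U /horner_eval hornerC.
  by rewrite map_polyX /horner_eval hornerX.
split.
  apply: contra_neq q0 => /polyP r0; apply/polyP => i; rewrite coef0.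
  by apply: xind; have := r0 i; rewrite coef_map coef0.
apply/rootP; rewrite -[RHS]pxl -[LHS]/(horner_eval _ _) /q !rmorph_mmap.
apply: eq_mmap => [c|i] /=; first by rewrite map_polyC /= mmapC /horner_eval hornerC.
rewrite /h /extend; case: unliftP => [j|] _ /=.
  by rewrite map_polyC /= mmapX mmap1U /horner_eval hornerC.
by rewrite map_polyX /horner_eval hornerX.
Qed.

(* z k v is the variable X_v for k <= v and the constant y v for v < k;
   spec k substitutes y k for X_k and ev substitutes y for all variables. *)
Lemma successive_specialization (M : fieldType) (s : nat) (y : 'I_s -> M) :
  exists (W : idomainType) (c : {rmorphism M -> W}) (z : nat -> 'I_s -> W)
      (spec : nat -> {rmorphism W -> W}) (ev : {rmorphism W -> M}),
  [/\ forall k a, spec k (c a) = c a, forall k v, spec k (z k v) = z k.+1 v,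
      forall k (v : 'I_s), (v < k)%N -> z k v = c (y v),
      forall v : 'I_s, z v v != c (y v) &
      (forall a, ev (c a) = a) /\ forall k v, ev (z k v) = y v].
Proof.
pose W : idomainType := {mpoly M[s]}.
pose c : {rmorphism M -> W} := @mpolyC s M.
pose z k (v : 'I_s) : W := if (v < k)%N then c (y v) else 'X_v.
pose spec k : {rmorphism W -> W} := mmap c (fun v => if v == k :> nat then c (y v) else 'X_v).
pose ev : {rmorphism W -> M} := mmap idfun y.
have specC k a : spec k (c a) = c a by rewrite /spec /= mmapC.
exists W, c, z, spec, ev; split=> [//|k v|k v ltvk|v|].
- rewrite /z ltnS (leq_eqVlt v); case: ltnP => [_|lekv]; first by rewrite orbT specC.
  by rewrite orbF /spec /= mmapX mmap1U.
- by rewrite /z ltvk.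
- rewrite /z ltnn; apply/eqP => /(congr1 (mcoeff U_(v))).
  rewrite mcoeffC mcoeffX eqxx mnm1_eq0 mulr0 => /eqP.
  by rewrite oner_eq0.
- split=> [a|k v]; first by rewrite /ev /= mmapC.
  by rewrite /z; case: ifP; rewrite /ev /= ?mmapC ?mmapX ?mmap1U.
Qed.

(** [F] is K(x), and [sigma k] maps a quotient of polynomials in [x] to the same quotient in the
    [z k (rho j)]. No nonzero denominator becomes 0, because [ev] sends the [z k (rho j)] to the
    independent elements [y (rho j)]. One numerator and one denominator serve all k, which gives
    coherence. *)
Lemma rational_specialization (K L M : fieldType) (f : {rmorphism K -> L})
    (fo : {rmorphism K -> M}) (m s : nat) (x : 'I_m -> L) (rho : 'I_m -> 'I_s)
    (y : 'I_s -> M) (W : idomainType) (c : {rmorphism M -> W})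
    (z : nat -> 'I_s -> W) (spec : nat -> {rmorphism W -> W})
    (ev : {rmorphism W -> M}) :
    alg_independent f x -> alg_independent fo (y \o rho) ->
    (forall k a, spec k (c a) = c a) -> (forall k v, spec k (z k v) = z k.+1 v) ->
    (forall a, ev (c a) = a) -> (forall k v, ev (z k v) = y v) ->
  exists (F : L -> Prop) (sigma : nat -> L -> {fraction W}),
  [/\ subfield F, (forall a, F (f a)) /\ (forall j, F (x j)),
      forall k a b, F a -> F b -> sigma k (a + b) = sigma k a + sigma k b /\
        sigma k (a * b) = sigma k a * sigma k b,
      (forall k a, sigma k (f a) = tofrac (c (fo a))) /\
        (forall k j, sigma k (x j) = tofrac (z k (rho j))) &
      forall a, F a -> coherent spec (fun k => sigma k a)].
Proof.
move=> xind yind specC specz evC evz.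
pose X : {rmorphism {mpoly K[m]} -> L} := mmap f x.
pose e k : {rmorphism {mpoly K[m]} -> W} := mmap (c \o fo) (z k \o rho).
have X0 q : (X q == 0) = (q == 0).
  by apply/eqP/eqP => [/xind //|->]; rewrite rmorph0.
have e0 k q : (e k q == 0) = (q == 0).
  apply/eqP/eqP => [eq0|->]; last by rewrite rmorph0.
  apply: yind; rewrite -(rmorph0 ev) -[in RHS]eq0 /e /= rmorph_mmap.
  by apply: eq_mmap => [a|j] /=; rewrite ?evC ?evz.
have espec k q : spec k (e k q) = e k.+1 q.
  by rewrite /e /= rmorph_mmap; apply: eq_mmap => [a|j] /=; rewrite ?specC ?specz.
pose rep l (pq : {mpoly K[m]} * {mpoly K[m]}) := pq.2 != 0 /\ l = X pq.1 / X pq.2.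
pose F l := exists pq, rep l pq.
pose val k (pq : {mpoly K[m]} * {mpoly K[m]}) : {fraction W} :=
  tofrac (e k pq.1) / tofrac (e k pq.2).
have val_eq k l pq pq' : rep l pq -> rep l pq' -> val k pq = val k pq'.
  case: pq pq' => p q [p' q'] [/= q0 ->] [/= q'0] /eqP.
  rewrite eqr_div ?X0 // -!rmorphM => /eqP/eqP.
  rewrite -subr_eq0 -rmorphB X0 subr_eq0 => /eqP pq.
  apply/eqP; rewrite /val /= eqr_div ?tofrac_eq0 ?e0 //.
  by rewrite -!rmorphM pq.
(* The value 0 outside [F] is a filler. *)
pose sigma k l : {fraction W} :=
  if boolp.pselect (F l) is left Fl then val k (projT1 (boolp.cid Fl)) else 0.
have sigmaE k l pq : rep l pq -> sigma k l = val k pq.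
  move=> lpq; rewrite /sigma; case: boolp.pselect => [Fl|[]]; last by exists pq.
  by case: boolp.cid => pq' /= /val_eq; apply.
exists F, sigma.
have rep_pol p : rep (X p) (p, 1) by rewrite /rep /= oner_neq0 rmorph1 divr1.
have repB a b pq pq' : rep a pq -> rep b pq' ->
    rep (a - b) (pq.1 * pq'.2 - pq'.1 * pq.2, pq.2 * pq'.2).
  move=> [q0 ->] [q'0 ->]; rewrite /rep /= mulf_neq0 //; split=> //.
  by rewrite rmorphB !rmorphM -!mulNr addf_div ?X0 // mulNr.
have repD a b pq pq' : rep a pq -> rep b pq' ->
    rep (a + b) (pq.1 * pq'.2 + pq'.1 * pq.2, pq.2 * pq'.2).
  move=> [q0 ->] [q'0 ->]; rewrite /rep /= mulf_neq0 //; split=> //.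
  by rewrite rmorphD !rmorphM addf_div ?X0.
have repM a b pq pq' : rep a pq -> rep b pq' ->
    rep (a * b) (pq.1 * pq'.1, pq.2 * pq'.2).
  move=> [q0 ->] [q'0 ->]; rewrite /rep /= mulf_neq0 //; split=> //.
  by rewrite !rmorphM mulf_div.
split.
- split; first split.
  + by exists (1, 1); rewrite -(rmorph1 X); apply: rep_pol.
  + by move=> a b [pq rpq] [pq' rpq']; eexists; exact: repB rpq rpq'.
  + by move=> a b [pq rpq] [pq' rpq']; eexists; exact: repM rpq rpq'.
  + move=> _ [[p q] [/= q0 ->]]; have [->|p0] := eqVneq p 0.
      by exists (0, 1); rewrite rmorph0 mul0r invr0 -(rmorph0 X); apply: rep_pol.
    by exists (q, p); rewrite /rep /= invf_div; split.
- split=> [a|j].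
    by exists (a%:MP, 1); have := rep_pol a%:MP; rewrite /X /= mmapC.
  by exists ('X_j, 1); have := rep_pol 'X_j; rewrite /X /= mmapX mmap1U.
- move=> k a b [pq rpq] [pq' rpq'].
  rewrite (sigmaE k _ _ rpq) (sigmaE k _ _ rpq').
  rewrite (sigmaE k _ _ (repD _ _ _ _ rpq rpq')) (sigmaE k _ _ (repM _ _ _ _ rpq rpq')).
  case: rpq rpq' => q0 _ [q'0 _]; rewrite /val /= !rmorphD !rmorphM.
  by rewrite addf_div ?mulf_div // tofrac_eq0 e0.
- split=> [k a|k j].
    have := rep_pol a%:MP; rewrite {1}/X /= mmapC => /sigmaE ->.
    by rewrite /val /= rmorph1 rmorph1 divr1 /e /= mmapC.
  have := rep_pol 'X_j; rewrite {1}/X /= mmapX mmap1U => /sigmaE ->.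
  by rewrite /val /= rmorph1 rmorph1 divr1 /e /= mmapX mmap1U.
- move=> a [pq rpq]; exists (fun k => e k pq.1), (fun k => e k pq.2) => k.
  by rewrite e0 (sigmaE k _ _ rpq) !espec; case: rpq.
Qed.

End MultivariatePolynomials.

From mathcomp Require Import boolp classical_sets constructive_ereal.
Local Open Scope quotient_scope.
Local Open Scope classical_set_scope.

(** * Chains of prime ideals and residue fields *)

(** [Zorn_bigcup] also covers the empty chain, whose union is empty, so it is applied to the sets
    that are good or empty. A maximal such set can be empty only if [I] is, and then [I] itself
    serves. *)
Lemma zorn_above (T : Type) (good : set T -> Prop) (I : set T) :
    good I ->
    (forall F : set (set T), F !=set0 -> (forall J, F J -> good J) ->
      total_on F subset -> good (\bigcup_(J in F) J)) ->
  exists2 P, good P & forall B, P `<` B -> ~ good B.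
Proof.
move=> Igood Fgood.
have [F FJ Ftot|P [Pgood Pmax]] := @Zorn_bigcup T (fun J => J = set0 \/ good J).
  have [F0|/set0P/cid[J FJ0]] := eqVneq (F `&` [set J | J !=set0]) set0.
    left; apply/seteqP; split=> x // [J FJ0 Jx].
    suff : set0 J by [].
    by rewrite -F0; split=> //; exists x.
  right; rewrite (_ : \bigcup_(J in F) J = \bigcup_(J in F `&` [set J | J !=set0]) J).
    apply: Fgood; first by exists J.
      by move=> G [/FJ[->|//] [x]].
    by move=> G H [FG _] [FH _]; apply: Ftot.
  apply/seteqP; split=> x [G FG Gx]; last by exists G => //; case: FG.
  by exists G => //; split=> //; exists x.
have nmax B : P `<` B -> ~ good B by move=> PB Bgood; apply: (Pmax B PB); right.
case: Pgood => [P0|Pgood]; last by exists P.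
have [I0|/set0P[x Ix]] := eqVneq I set0; first by exists I => // B; rewrite I0 -P0; apply: nmax.
by case: (nmax I) => //; rewrite P0; split=> // /(_ x Ix).
Qed.

Section PrimeIdeals.
Variable A : comPzRingType.
Implicit Types (I P S : set A) (a b x y : A).

Definition ideal I : Prop :=
  [/\ I 0, forall x y, I x -> I y -> I (x + y) & forall a x, I x -> I (a * x)].

(** An ideal maximal among those that contain [I] and avoid [S] is prime: if it contained x * y but
    neither factor, its enlargements by x and by y would both meet [S], and the product of two
    meeting points would lie in the ideal and in [S]. *)
Lemma prime_avoidance I S : ideal I -> S 1 -> (forall x y, S x -> S y -> S (x * y)) ->
  (forall x, I x -> S x -> False) ->
  exists P, [/\ prime_ideal P, I `<=` P & forall x, P x -> S x -> False].
Proof.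
move=> [I0 ID IM] S1 SM IS.
pose good (J : set A) :=
  [/\ ideal J, I `<=` J & forall x, J x -> S x -> False].
have [|F [J FJ] Fgood Ftot|P [[P0 PD PM] IP PS] Pmax] := @zorn_above A good I.
- by split.
- have [[J0 _ _] IJ _] := Fgood J FJ; split.
  + split; first by exists J.
      move=> x y [G FG Gx] [H FH Hy].
      have [[_ GD _] _ _] := Fgood _ FG; have [[_ HD _] _ _] := Fgood _ FH.
      case: (Ftot G H FG FH) => sub; first by exists H => //; apply: HD => //; apply: sub.
      by exists G => //; apply: GD => //; apply: sub.
    by move=> a x [G FG Gx]; have [[_ _ GM] _ _] := Fgood _ FG; exists G => //; apply: GM.
  + by move=> x /IJ Jx; exists J.
  + by move=> x [G FG Gx]; have [_ _] := Fgood _ FG; apply.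
exists P; split=> //; split=> //; first by move=> /PS; apply.
move=> x y Pxy; apply: contrapT => /not_orP [nPx nPy].
have extend z : ~ P z -> exists a p, P p /\ S (p + a * z).
  move=> nPz; apply: contrapT => noS.
  pose Q := [set w | exists a p, P p /\ w = p + a * z].
  apply: (Pmax Q); first split.
  - by move=> p Pp; exists 0, p; rewrite mul0r addr0.
  - by move=> /(_ z) PQ; apply: nPz; apply: PQ; exists 1, 0; rewrite mul1r add0r.
  split; first split.
  - by exists 0, 0; rewrite mul0r addr0.
  - move=> _ _ [a [p [Pp ->]]] [b [q [Pq ->]]]; exists (a + b), (p + q).
    by split; [apply: PD|rewrite mulrDl addrACA].
  - move=> c _ [a [p [Pp ->]]]; exists (c * a), (c * p).
    by split; [apply: PM|rewrite mulrDr mulrA].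
  - by move=> w /IP Pw; exists 0, w; rewrite mul0r addr0.
  - by move=> _ [a [p [Pp ->]]] Sw; apply: noS; exists a, p.
have [a [p [Pp Spx]]] := extend x nPx; have [b [q [Pq Sqy]]] := extend y nPy.
apply: (PS _ _ (SM _ _ Spx Sqy)).
rewrite mulrDr 2!mulrDl; apply: (PD); first by apply: (PD); apply: PM.
apply: (PD); first by rewrite mulrC; apply: (PM).
by rewrite mulrACA; apply: PM.
Qed.

Lemma prime_idealN P x : prime_ideal P -> P x -> P (- x).
Proof. by case=> _ _ PM _ _ Px; rewrite -mulN1r; apply: PM. Qed.

Lemma prime_idealB P x y : prime_ideal P -> P x -> P y -> P (x - y).
Proof.
by move=> Pp Px Py; have [_ PD _ _ _] := Pp; apply: PD => //; apply: prime_idealN.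
Qed.

(* The prime below P k.+1 avoids all a * u k ^+ j with a outside P k.+1, so it
   does not contain u k. *)
Lemma prime_chain_regular (s : nat) (I : nat -> set A) (u : nat -> A) :
    (forall k, (k <= s)%N -> ideal (I k)) -> ~ I s 1 ->
    (forall k, (k < s)%N -> I k `<=` I k.+1) ->
    (forall k, (k < s)%N -> I k.+1 (u k)) ->
    (forall k a, (k < s)%N -> I k (u k * a) -> I k a) ->
  has_prime_chain A s.
Proof.
move=> Iid Is1 Imono Iu Ireg.
suff [P [Pprime _ Plt]] : exists P : nat -> set A,
    [/\ forall i, (i <= s)%N -> prime_ideal (P i), I 0%N `<=` P 0%N &
        forall i, (i < s)%N -> P i `<` P i.+1] by exists P.
elim: s I u Iid Is1 Imono Iu Ireg => [|s IHs] I u Iid Is1 Imono Iu Ireg.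
  have [||||P [Pprime IP _]] := @prime_avoidance (I 0%N) [set 1].
  - exact: Iid.
  - by [].
  - by move=> _ _ -> ->; rewrite /= mulr1.
  - by move=> x Ix x1; rewrite -x1 in Is1.
  by exists (fun=> P).
have [|//|||k a ks|P [Pprime IP Plt]] := IHs (I \o S) (u \o S).
- by move=> k ks; apply: Iid.
- by move=> k ks; apply: Imono.
- by move=> k ks; apply: Iu.
- exact: Ireg.
have [Q0 QD QM Q1 Qpr] := Pprime 0%N isT.
pose T := [set x | exists2 a, ~ P 0%N a & exists j, x = u 0%N ^+ j * a].
have [||||Q [Qprime IQ QT]] := @prime_avoidance (I 0%N) T.
- exact: Iid.
- by exists 1 => //; exists 0%N; rewrite expr0 mul1r.
- move=> _ _ [a Pa [i ->]] [b Pb [j ->]]; exists (a * b); first by case/Qpr.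
  by exists (i + j)%N; rewrite mulrACA exprD.
(* Cancelling the powers of [u 0] modulo [I 0] would put [a] in [P 0]. *)
- move=> x + [a Pa [j xE]]; rewrite {x}xE; elim: j => [|j IHj].
    by rewrite expr0 mul1r => /(Imono 0%N isT)/IP.
  by rewrite exprS -mulrA => /(Ireg 0%N _ isT).
exists (fun k => if k is k'.+1 then P k' else Q); split=> //.
  by case=> // i; apply: Pprime.
case=> [|i] /= si; last exact: Plt.
split.
  move=> x Qx; apply: contrapT => nPx; apply: (QT x Qx).
  by exists x => //; exists 0%N; rewrite expr0 mul1r.
move=> /(_ (u 0%N) (IP _ (Iu 0%N isT))) Qu; apply: (QT _ Qu).
by exists 1 => //; exists 1%N; rewrite expr1 mulr1.
Qed.

Lemma prime_chain_sub (P : nat -> set A) (d i : nat) :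
  (forall j, (j < d)%N -> P j `<` P j.+1) -> (i <= d)%N -> P 0%N `<=` P i.
Proof.
move=> Plt; elim: i => [_|i IHi lti]; first by [].
by apply: subset_trans (IHi (ltnW lti)) _; case: (Plt i lti).
Qed.

End PrimeIdeals.

Section ResidueField.
Variables (A : comPzRingType) (P : set A).
Hypothesis Pprime : prime_ideal P.

Lemma residue_nontrivial : (1 : A) != 0.
Proof. by case: Pprime => P0 _ _ P1 _; apply/eqP => e; apply: P1; rewrite e. Qed.

(** A copy of [A] on which the nonzero-ring structure, available because 1 is outside [P], can be
    declared. *)
Definition nontrivial_ring : Type := A.
HB.instance Definition _ := GRing.ComPzRing.on nontrivial_ring.
HB.instance Definition _ :=
  GRing.PzSemiRing_isNonZero.Build nontrivial_ring residue_nontrivial.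

Definition in_prime : {pred nontrivial_ring} := fun x => `[< P x >].

Fact in_prime_idealr_closed : idealr_closed in_prime.
Proof.
case: Pprime => P0 PD PM P1 _; split; first exact/asboolP.
  by apply/asboolP.
by move=> a x y /asboolP Px /asboolP Py; apply/asboolP/PD => //; apply: PM.
Qed.
HB.instance Definition _ := isIdealr.Build nontrivial_ring in_prime in_prime_idealr_closed.

Fact in_prime_prime_closed : prime_idealr_closed in_prime.
Proof.
by case: Pprime => _ _ _ _ PM x y /asboolP/PM [] H; apply/orP; [left|right]; apply/asboolP.
Qed.
HB.instance Definition _ :=
  isPrimeIdealrClosed.Build nontrivial_ring in_prime in_prime_prime_closed.

Definition residue_domain : Type := {ideal_quot in_prime}.
HB.instance Definition _ := GRing.ComNzRing.on residue_domain.

(** Units and inverses are chosen classically, since the integral domains that have a fraction field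
    carry an inverse operation. *)
Definition residue_unit : pred residue_domain := fun x => `[< exists y, y * x = 1 >].
Definition residue_inv (x : residue_domain) : residue_domain :=
  if pselect (exists y, y * x = 1) is left e then projT1 (cid e) else x.

Fact residue_mulVx : {in residue_unit, left_inverse 1 residue_inv *%R}.
Proof.
move=> x /asboolP ux; rewrite /residue_inv; case: pselect => // e.
by case: (cid e).
Qed.

Fact residue_unitPl x y : y * x = 1 -> x \in residue_unit.
Proof. by move=> yx; apply/asboolP; exists y. Qed.

Fact residue_inv_out : {in [predC residue_unit], residue_inv =1 id}.
Proof.
by move=> x /asboolP nux; rewrite /residue_inv; case: pselect.
Qed.

HB.instance Definition _ := GRing.ComNzRing_hasMulInverse.Build residue_domain
  residue_mulVx residue_unitPl residue_inv_out.

Fact residue_integral : GRing.integral_domain_axiom residue_domain.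
Proof. by move=> x y /Quotient.rquot_IdomainAxiom. Qed.

HB.instance Definition _ := GRing.ComUnitRing_isIntegral.Build residue_domain
  residue_integral.

(** [E] is the fraction field of the domain A/P. *)
Lemma residue_field : exists (E : fieldType) (r : {rmorphism A -> E}),
  forall a, r a = 0 <-> P a.
Proof.
pose pr (a : A) : residue_domain := \pi_{ideal_quot in_prime} (a : nontrivial_ring).
pose r : A -> {fraction residue_domain} := fun a => @tofrac residue_domain (pr a).
have rB : zmod_morphism r.
  by move=> a b; rewrite /r -rmorphB /pr; congr tofrac; rewrite /= rmorphB.
have rM : monoid_morphism r.
  split=> [|a b]; first by rewrite /r /pr rmorph1 rmorph1.
  by rewrite /r -rmorphM /pr; congr tofrac; rewrite rmorphM.
pose rA := GRing.isZmodMorphism.Build _ _ r rB.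
pose rAM := GRing.isMonoidMorphism.Build _ _ r rM.
pose rr : {rmorphism A -> {fraction residue_domain}} := HB.pack r rA rAM.
exists {fraction residue_domain}, rr => a /=; rewrite /r.
split=> [/eqP|Pa].
  rewrite tofrac_eq0 /pr -(rmorph0 \pi_{ideal_quot in_prime}) -Quotient.idealrBE subr0.
  by move/asboolP.
apply/eqP; rewrite tofrac_eq0 /pr -(rmorph0 \pi_{ideal_quot in_prime}) -Quotient.idealrBE subr0.
exact/asboolP.
Qed.
End ResidueField.

(** * Algebraic dependence and Steinitz exchange *)

Section Steinitz.
Variables (T : Type) (cl : set T -> set T).
Hypothesis cl_ext : forall S, S `<=` cl S.
Hypothesis cl_idem : forall S S', S `<=` cl S' -> cl S `<=` cl S'.
Hypothesis cl_exchange : forall S y z, cl (S `|` [set y]) z -> ~ cl S z ->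
  cl (S `|` [set z]) y.

Fixpoint cl_indep (S : set T) (ys : seq T) : Prop :=
  if ys is y :: ys' then ~ cl S y /\ cl_indep (S `|` [set y]) ys' else True.

Fixpoint adds (S : set T) (xs : seq T) : set T :=
  if xs is x :: xs' then adds (S `|` [set x]) xs' else S.

Lemma cl_mono S S' : S `<=` S' -> cl S `<=` cl S'.
Proof. by move=> sub; apply: cl_idem => x /sub; apply: cl_ext. Qed.

Lemma sub_adds S xs : S `<=` adds S xs.
Proof.
by elim: xs S => [|x xs IH] S z Sz /=; [|apply: IH; left].
Qed.

Lemma cl_adds S S' xs : S `<=` cl S' -> adds S xs `<=` cl (adds S' xs).
Proof.
elim: xs S S' => [//|x xs IH] S S' sub /=; apply: IH => z [/sub|->].
  by apply: cl_mono; apply: subsetUl.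
by apply: cl_ext; right.
Qed.

(** When the entries of [xs] are added one at a time, [y] replaces the first one whose addition
    brings [y] into the closure. By exchange, that entry lies in the closure of [y] and what
    precedes it. *)
Lemma cl_swap S xs y : cl (adds S xs) y -> ~ cl S y ->
  exists xs', size xs = (size xs').+1 /\ adds S xs `<=` cl (adds (S `|` [set y]) xs').
Proof.
elim: xs S => [|x xs IH] S /= yxs nSy; first by [].
have [Sxy|nSxy] := pselect (cl (S `|` [set x]) y).
  exists xs; split=> //; apply: cl_adds => z [Sz|->].
    by apply: cl_ext; left.
  exact: cl_exchange.
have [xs' [-> sub]] := IH _ yxs nSxy; exists (x :: xs'); split=> //=.
by rewrite setUAC.
Qed.

(** Each entry of [ys] in turn is swapped for one entry of [xs], while the later entries of [ys]
    stay in the closure. *)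
Lemma cl_indep_size S ys xs : cl_indep S ys ->
  (forall i, (i < size ys)%N -> forall y0, cl (adds S xs) (nth y0 ys i)) ->
  (size ys <= size xs)%N.
Proof.
elim: ys S xs => [|y ys IH] S xs //= [nSy ind] span.
have [xs' [-> sub]] := cl_swap (span 0%N isT y) nSy.
apply: IH ind _ => i lti y0; apply: (cl_idem sub); exact: span i.+1 _ y0.
Qed.
End Steinitz.

Section AlgebraicClosure.
Variable E : fieldType.
Implicit Types (R S k : set E) (x y z c : E) (p q : {poly E}).

Definition coefs_in R p : Prop := forall i, R p`_i.

(** In practice [R] is a subring; by [alg_fractions], algebraicity over it is the same as over its
    field of fractions. *)
Definition alg R : set E := [set y | exists p, [/\ p != 0, coefs_in R p & root p y]].

Definition fractions R : set E := [set y | exists a b, [/\ R a, R b & y = a / b]].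

Definition generated S : set E := [set x | forall R, subring R -> S `<=` R -> R x].

Lemma subring0 R : subring R -> R 0.
Proof. by case=> R1 RB _; rewrite -(subrr 1); apply: RB. Qed.

Lemma subringN R x : subring R -> R x -> R (- x).
Proof.
by move=> Rs Rx; have [_ RB _] := Rs; rewrite -sub0r; apply: RB => //; apply: subring0.
Qed.

Lemma subringD R x y : subring R -> R x -> R y -> R (x + y).
Proof.
move=> Rs Rx Ry; have [_ RB _] := Rs.
by rewrite -[y]opprK; apply: RB => //; apply: subringN.
Qed.

Lemma subring_sum R (I : finType) (F : I -> E) : subring R -> (forall i, R (F i)) ->
  R (\sum_i F i).
Proof.
move=> Rs RF; apply: (big_ind R) => //; first exact: subring0.
by move=> x y; apply: subringD.
Qed.

Lemma subringX R x n : subring R -> R x -> R (x ^+ n).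
Proof.
move=> [R1 _ RM] Rx; elim: n => [|n IHn]; first by rewrite expr0.
by rewrite exprS; apply: RM.
Qed.

Lemma subring_range (A : pzRingType) (r : {rmorphism A -> E}) : subring (range r).
Proof.
split; first by exists 1 => //; rewrite rmorph1.
  by move=> _ _ [a _ <-] [b _ <-]; exists (a - b) => //; rewrite rmorphB.
by move=> _ _ [a _ <-] [b _ <-]; exists (a * b) => //; rewrite rmorphM.
Qed.

Lemma subring_generated S : subring (generated S).
Proof.
split=> [R [] //|x y gx gy R Rs SR|x y gx gy R Rs SR]; case: (Rs) => [R1 RB RM].
  by apply: RB; [apply: gx|apply: gy].
by apply: RM; [apply: gx|apply: gy].
Qed.

Lemma sub_generated S : S `<=` generated S.
Proof. by move=> x Sx R _; apply. Qed.

Lemma generated_min S R : subring R -> S `<=` R -> generated S `<=` R.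
Proof. by move=> Rs SR x; apply. Qed.

Lemma coefs_in0 R : subring R -> coefs_in R 0.
Proof. by move=> Rs i; rewrite coef0; apply: subring0. Qed.

Lemma coefs_inC R c : subring R -> R c -> coefs_in R c%:P.
Proof. by move=> Rs Rc i; rewrite coefC; case: ifP => // _; apply: subring0. Qed.

Lemma coefs_inX R : subring R -> coefs_in R 'X.
Proof. by move=> Rs i; rewrite coefX; case: Rs (subring0 Rs) => R1 _ _ R0; case: eqP. Qed.

Lemma coefs_inB R p q : subring R -> coefs_in R p -> coefs_in R q -> coefs_in R (p - q).
Proof. by move=> [_ RB _] Rp Rq i; rewrite coefB; apply: RB. Qed.

Lemma coefs_inD R p q : subring R -> coefs_in R p -> coefs_in R q -> coefs_in R (p + q).
Proof. by move=> Rs Rp Rq i; rewrite coefD; apply: subringD. Qed.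

Lemma coefs_inM R p q : subring R -> coefs_in R p -> coefs_in R q -> coefs_in R (p * q).
Proof.
move=> Rs Rp Rq i; rewrite coefM; apply: subring_sum => // j.
by have [_ _ RM] := Rs; apply: RM.
Qed.

Lemma coefs_in_mulXaddC R p c : coefs_in R (p * 'X + c%:P) -> coefs_in R p /\ R c.
Proof.
move=> Rpc; split=> [i|]; last by have := Rpc 0%N; rewrite coefD coefMX coefC add0r.
by have := Rpc i.+1; rewrite coefD coefMX coefC addr0.
Qed.

Lemma horner_coefs_in R p x : subring R -> coefs_in R p -> R x -> R p.[x].
Proof.
move=> Rs Rp Rx; rewrite horner_coef; apply: subring_sum => // i.
by have [_ _ RM] := Rs; apply: RM => //; apply: subringX.
Qed.

Definition adjoin R y : set E := [set z | exists2 p, coefs_in R p & z = p.[y]].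

Lemma subring_adjoin R y : subring R -> subring (adjoin R y).
Proof.
move=> Rs; split.
- by exists 1; rewrite ?hornerC //; apply: coefs_inC => //; case: Rs.
- by move=> _ _ [p Rp ->] [q Rq ->]; exists (p - q); rewrite ?hornerE //; apply: coefs_inB.
- by move=> _ _ [p Rp ->] [q Rq ->]; exists (p * q); rewrite ?hornerE //; apply: coefs_inM.
Qed.

Lemma adjoinE S y : generated (S `|` [set y]) = adjoin (generated S) y.
Proof.
have gs := subring_generated S.
apply/seteqP; split=> [|_ [p gp ->]].
  apply: generated_min; first exact: subring_adjoin.
  move=> z [Sz|->].
    by exists z%:P; rewrite ?hornerC //; apply: coefs_inC => //; apply: sub_generated.
  by exists 'X; rewrite ?hornerX //; apply: coefs_inX.
apply: (@horner_coefs_in (generated (S `|` [set y]))); first exact: subring_generated.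
  move=> i; have := gp i; apply: generated_min; first exact: subring_generated.
  by move=> z Sz; apply: sub_generated; left.
by apply: sub_generated; right.
Qed.

Lemma sub_alg R : subring R -> R `<=` alg R.
Proof.
move=> Rs x Rx; exists ('X - x%:P); rewrite polyXsubC_eq0 root_XsubC eqxx; split=> //.
by apply: coefs_inB => //; [apply: coefs_inX|apply: coefs_inC].
Qed.

Lemma alg_mono R R' : R `<=` R' -> alg R `<=` alg R'.
Proof. by move=> RR' y [p [p0 Rp py]]; exists p; split=> // i; apply: RR'. Qed.

Lemma subfield_fractions R : subring R -> subfield (fractions R).
Proof.
move=> Rs; have [R1 RB RM] := Rs; split; first split.
- by exists 1, 1; rewrite divr1.
- move=> _ _ [a [b [Ra Rb ->]]] [c [d [Rc Rd ->]]].
  have [->|b0] := eqVneq b 0; first exists (- c), d.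
    by rewrite invr0 mulr0 sub0r mulNr; split=> //; apply: subringN.
  have [->|d0] := eqVneq d 0; first by exists a, b; rewrite invr0 mulr0 subr0.
  exists (a * d - c * b), (b * d); split; [by apply: (RB); apply: RM|exact: RM|].
  by rewrite -mulNr addf_div // mulNr.
- move=> _ _ [a [b [Ra Rb ->]]] [c [d [Rc Rd ->]]].
  by exists (a * c), (b * d); rewrite mulf_div; split=> //; apply: RM.
- by move=> _ [a [b [Ra Rb ->]]]; exists b, a; rewrite invf_div.
Qed.

Lemma sub_fractions R : subring R -> R `<=` fractions R.
Proof. by case=> R1 _ _ x Rx; exists x, 1; rewrite divr1. Qed.

Lemma clear_denominators R p : subring R -> coefs_in (fractions R) p ->
  exists2 c, R c /\ c != 0 & coefs_in R (c *: p).
Proof.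
move=> Rs; have [R1 _ RM] := Rs; elim/poly_ind: p => [|p c IHp] fp.
  by exists 1; rewrite ?oner_neq0 // scaler0; apply: coefs_in0.
have {fp} [/IHp [d [Rd d0] Rdp] [a [b [Ra Rb ->]]]] := coefs_in_mulXaddC fp.
(* If [b] is 0, then so is a / b, and [d] already clears all denominators. *)
have [b0|b0] := eqVneq b 0.
  exists d => //; rewrite b0 invr0 mulr0 addr0 scalerAl.
  by apply: coefs_inM => //; apply: coefs_inX.
exists (d * b); first by rewrite mulf_neq0 //; split=> //; apply: RM.
rewrite scalerDr; apply: coefs_inD => //.
  rewrite scalerAl; apply: coefs_inM; [by []| |exact: coefs_inX].
  by move=> i; rewrite mulrC -scalerA coefZ; apply: RM.
rewrite -mul_polyC -polyCM -mulrA (mulrC b) divfK //.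
by apply: coefs_inC => //; apply: RM.
Qed.

Lemma alg_fractions R : subring R -> alg (fractions R) = alg R.
Proof.
move=> Rs; apply/seteqP; split; last by apply: alg_mono; apply: sub_fractions.
move=> y [p [p0 fp py]]; have [c [Rc c0] Rcp] := clear_denominators Rs fp.
exists (c *: p); split=> //; first by rewrite scaler_eq0 negb_or c0.
by rewrite /root hornerZ mulf_eq0 (eqP py) eqxx orbT.
Qed.

Section SubfieldType.
Variables (k : set E) (ksub : subfield k).

Definition in_subfield : {pred E} := fun x => `[< k x >].

Fact in_subfield_closed : divring_closed in_subfield.
Proof.
case: ksub => -[k1 kB kM] kV; split; first exact/asboolP.
  by move=> x y /asboolP kx /asboolP ky; apply/asboolP/kB.
by move=> x y /asboolP kx /asboolP ky; apply/asboolP/kM => //; apply: kV.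
Qed.
HB.instance Definition _ := GRing.isDivringClosed.Build E in_subfield in_subfield_closed.

(** A subfield given as a set becomes a field type, so that the closure properties of
    [algebraicOver] can be transferred to [alg]. *)
Record subfield_type := SubfieldType {subfield_val : E; _ : subfield_val \in in_subfield}.
HB.instance Definition _ := [isSub for subfield_val].
HB.instance Definition _ := [Choice of subfield_type by <:].
HB.instance Definition _ := [SubChoice_isSubIntegralDomain of subfield_type by <:].
HB.instance Definition _ := [SubIntegralDomain_isSubField of subfield_type by <:].

Let val_k : {rmorphism subfield_type -> E} := val.

Lemma alg_subfieldE y : alg k y <-> algebraicOver val_k y.
Proof.
split=> [[p [p0 kp py]]|[p p0 py]]; last first.
  exists (map_poly val_k p); rewrite map_poly_eq0; split=> // i.
  by rewrite coef_map; apply/asboolP; exact: (valP p`_i).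
have pE : p = map_poly val_k
    (\poly_(i < size p) SubfieldType (asboolT (kp i) : _ \in in_subfield)).
  apply/polyP => i; rewrite coef_map coef_poly; case: ltnP => [_ //|le].
  by rewrite [RHS](rmorph0 val_k) nth_default.
exists (\poly_(i < size p) SubfieldType (asboolT (kp i) : _ \in in_subfield)); rewrite -?pE //.
by rewrite -(map_poly_eq0 val_k) -pE.
Qed.

Lemma subfield_alg : subfield (alg k).
Proof.
split; first split.
- by apply/alg_subfieldE; apply: algebraic1.
- by move=> x y /alg_subfieldE ax /alg_subfieldE ay; apply/alg_subfieldE/algebraic_sub.
- by move=> x y /alg_subfieldE ax /alg_subfieldE ay; apply/alg_subfieldE/algebraic_mul.
- by move=> x /alg_subfieldE ax; apply/alg_subfieldE/algebraic_inv.
Qed.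

Lemma alg_alg_subfield : alg (alg k) `<=` alg k.
Proof.
move=> y [p [p0 ap py]]; apply/alg_subfieldE/integral_algebraic.
apply: (integral_root p0 py); apply/integral_poly => i.
by apply/integral_algebraic/alg_subfieldE.
Qed.
End SubfieldType.

Definition alg_closure S := alg (generated S).

Lemma subfield_alg_closure S : subfield (alg_closure S).
Proof.
rewrite /alg_closure -alg_fractions; last exact: subring_generated.
by apply: subfield_alg; apply: subfield_fractions; apply: subring_generated.
Qed.

Lemma alg_closure_ext S : S `<=` alg_closure S.
Proof.
apply: subset_trans (@sub_generated S) _; apply: sub_alg; exact: subring_generated.
Qed.

(** This is transitivity of algebraicity, used over the fraction field of the subring generated by
    [S']. *)
Lemma alg_closure_idem S S' : S `<=` alg_closure S' -> alg_closure S `<=` alg_closure S'.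
Proof.
move=> /(generated_min (proj1 (subfield_alg_closure S')))/alg_mono sub.
apply: subset_trans sub _; rewrite /alg_closure -(alg_fractions (subring_generated S')).
by apply: alg_alg_subfield; apply: subfield_fractions; apply: subring_generated.
Qed.

Lemma adjoin_poly R y p : subring R -> coefs_in (adjoin R y) p ->
  exists2 P : {poly {poly E}}, forall i, coefs_in R P`_i & p = map_poly (horner_eval y) P.
Proof.
move=> Rs; elim/poly_ind: p => [|p c IHp].
  by exists 0 => [i|]; rewrite ?rmorph0 // coef0; apply: coefs_in0.
case/coefs_in_mulXaddC => /IHp [P RP ->] [q Rq ->].
exists (P * 'X + q%:P); last first.
  by rewrite rmorphD rmorphM /= map_polyX map_polyC.
case=> [|i]; first by rewrite coefD coefMX coefC add0r.
by rewrite coefD coefMX coefC addr0.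
Qed.

(** An equation of z over R[y] has the form P(z, y) = 0 with P over R, and is also an equation of y
    over R[z]. It is nontrivial: otherwise a nonzero coefficient of a power of y would be a
    polynomial over R vanishing at z, and z would be algebraic over R. *)
Lemma alg_closure_exchange S y z : alg_closure (S `|` [set y]) z -> ~ alg_closure S z ->
  alg_closure (S `|` [set z]) y.
Proof.
rewrite /alg_closure !adjoinE; set R := generated S.
have Rs : subring R := subring_generated S.
move=> [p [p0 Rp pz]] nRz; have [P RP pE] := adjoin_poly Rs Rp.
exists (map_poly (horner_eval z) (swapXY P)); split.
- apply/eqP => /polyP w0; move/eqP: p0; apply; rewrite pE.
  suff -> : P = 0 by rewrite rmorph0.
  apply/eqP; rewrite -swapXY_eq0; apply/eqP/polyP => j; rewrite coef0.
  apply: contrapT => /eqP Pj; apply: nRz; exists (swapXY P)`_j; split=> //.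
    by move=> i; rewrite coef_swapXY; apply: RP.
  by have := w0 j; rewrite coef_map coef0 /= => /eqP.
- move=> i; rewrite coef_map /=; exists (swapXY P)`_i => // j.
  by rewrite coef_swapXY; apply: RP.
- by rewrite /root -horner_polyC -horner2_swapXY horner_swapXY -pE.
Qed.

End AlgebraicClosure.

(** * Tensor products *)

Section RestrictScalars.
Variables (R : comNzRingType) (E : comNzRingType) (g : {rmorphism R -> E}).

(** The dummy [let] keeps [g] in the type, so that each [g] gets its own module structure. *)
Definition restrict_scalars : Type := let _ := g in E.
HB.instance Definition _ := GRing.Zmodule.on restrict_scalars.

Definition restrict_scale (c : R) (x : restrict_scalars) : restrict_scalars :=
  g c * (x : E).

Fact restrict_scaleA a b v :
  restrict_scale a (restrict_scale b v) = restrict_scale (a * b) v.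
Proof. by rewrite /restrict_scale rmorphM mulrA. Qed.
Fact restrict_scale1 : left_id 1 restrict_scale.
Proof. by move=> x; rewrite /restrict_scale rmorph1 mul1r. Qed.
Fact restrict_scaleDr : right_distributive restrict_scale +%R.
Proof. by move=> a x y; rewrite /restrict_scale mulrDr. Qed.
Fact restrict_scaleDl v : {morph restrict_scale^~ v : a b / a + b}.
Proof. by move=> a b; rewrite /restrict_scale rmorphD mulrDl. Qed.

HB.instance Definition _ := GRing.Zmodule_isLmodule.Build R restrict_scalars
  restrict_scaleA restrict_scale1 restrict_scaleDr restrict_scaleDl.

End RestrictScalars.

Section Tensor.
Variables (I : finType) (R : comNzRingType) (A : I -> comPzRingType).
Variables (f : forall i, {rmorphism R -> A i}) (o : I).

Definition tensor_in (i : I) (a : A i) : tensor f :=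
  pure_tensor f (dfwith (@family_one I A) a).

Lemma dfwith_id (x : Defs.family A) i : dfwith x (x i) = x.
Proof.
apply: functional_extensionality_dep => j.
by have [<-|ij] := eqVneq i j; rewrite ?dfwith_in ?dfwith_out.
Qed.

Lemma pi_tensor_scale (x : Defs.family A) i c :
  \pi_(tensor f) (c *: gen R x) = pure_tensor f (dfwith x (f i c * x i)).
Proof.
apply/esym/tensor_eqP; rewrite -[in c *: _](dfwith_id x i).
exact: tensor_rel_scale.
Qed.

(** The index [o] provides a factor that absorbs the scalar in front of each generator. *)
Lemma tensor_ind (P : tensor f -> Prop) :
    P 0 -> (forall s t, P s -> P t -> P (s + t)) ->
    (forall x, P (pure_tensor f x)) ->
  forall t, P t.
Proof.
move=> P0 PD Ppure t; case: (tensorP t) => u.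
elim/free_module_ind: u => [|c x u IHu]; first by rewrite raddf0.
by rewrite pi_tensorD (pi_tensor_scale x o); apply: PD.
Qed.

Lemma tensor_inD i (a b : A i) : tensor_in (a + b) = tensor_in a + tensor_in b.
Proof. exact: pure_tensorD. Qed.

Lemma tensor_in_mul i (a : A i) x :
  tensor_in a * pure_tensor f x = pure_tensor f (dfwith x (a * x i)).
Proof.
by rewrite -pure_tensorM family_mul_dfwith family_mul1.
Qed.

Lemma tensor_inM i (a b : A i) : tensor_in (a * b) = tensor_in a * tensor_in b.
Proof.
rewrite tensor_in_mul /tensor_in dfwith_in; congr pure_tensor.
apply: functional_extensionality_dep => j.
by have [<-|ij] := eqVneq i j; rewrite ?dfwith_in ?dfwith_out.
Qed.

Lemma tensor_in1 i : tensor_in (1 : A i) = 1.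
Proof. exact: (congr1 (pure_tensor f) (dfwith_id (@family_one I A) i)). Qed.

Lemma tensor_in_scalar i j c : tensor_in (f i c) = tensor_in (f j c).
Proof.
rewrite /tensor_in -[f i c]mulr1 -[f j c]mulr1.
by rewrite -!(pi_tensor_scale (@family_one I A)).
Qed.

Fact tensor_in_zmod i : zmod_morphism (@tensor_in i).
Proof. by move=> a b; rewrite -[in RHS](subrK b a) (tensor_inD (a - b)) addrK. Qed.
Fact tensor_in_monoid i : monoid_morphism (@tensor_in i).
Proof. by split; [exact: tensor_in1|exact: tensor_inM]. Qed.
HB.instance Definition _ i :=
  GRing.isZmodMorphism.Build _ _ (@tensor_in i) (@tensor_in_zmod i).
HB.instance Definition _ i :=
  GRing.isMonoidMorphism.Build _ _ (@tensor_in i) (@tensor_in_monoid i).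

Lemma pure_tensor_prod x : pure_tensor f x = \prod_i tensor_in (x i).
Proof.
suff prodE s : uniq s -> \prod_(i <- s) tensor_in (x i) =
    pure_tensor f (fun i => if i \in s then x i else 1).
  rewrite prodE ?index_enum_uniq //; congr pure_tensor.
  by apply: functional_extensionality_dep => i; rewrite mem_index_enum.
elim: s => [_|i s IHs /= /andP[nis us]]; first by rewrite big_nil.
rewrite big_cons IHs // tensor_in_mul; congr pure_tensor.
apply: functional_extensionality_dep => j; rewrite inE.
have [<-|ij] := eqVneq i j; first by rewrite dfwith_in (negbTE nis) mulr1.
by rewrite dfwith_out.
Qed.

(** Meant for retractions, which are linear but need not be multiplicative; hence [phi] is only
    additive. Viewing [E] as a module through [g] makes the product of the [mu i] multilinear, as
    [tensor_lift] requires. *)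
Lemma tensor_prod_map (E : comNzRingType) (g : {rmorphism R -> E})
    (mu : forall i, A i -> E) :
    (forall i a b, mu i (a + b) = mu i a + mu i b) ->
    (forall i c a, mu i (f i c * a) = g c * mu i a) ->
  exists phi : tensor f -> E, {morph phi : s t / s + t} /\
    forall x, phi (pure_tensor f x) = \prod_i mu i (x i).
Proof.
move=> muD muZ.
pose h (x : Defs.family A) : restrict_scalars g := \prod_i mu i (x i).
have hE x i (a : A i) : h (dfwith x a) = mu i a * \prod_(j | j != i) mu j (x j) :> E.
  rewrite /h (bigD1 i) //= dfwith_in; congr (_ * _).
  by apply: eq_bigr => j ji; rewrite dfwith_out // eq_sym.
have [x i a b|x i c a|phi [phiD phiE]] := @tensor_lift I R A f (restrict_scalars g) h.
- by rewrite [LHS]hE muD mulrDl -!hE.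
- by rewrite [LHS]hE muZ -mulrA -hE.
exists phi; split=> // x; have := phiE 1 x.
by rewrite !scale1r.
Qed.
End Tensor.

(** * Upper bound *)

Lemma mem_adds (T : eqType) (S : set T) (xs : seq T) x : x \in xs -> adds S xs x.
Proof.
elim: xs S => [//|z xs IH] S /=; rewrite inE => /predU1P[->|]; last exact: IH.
by apply: sub_adds; right.
Qed.

(* Elements q_j of P j.+1 outside P j, taken for j = d.-1, ..., 0, are successively
   transcendental modulo P 0: as long as the subring generated so far meets P j.+1
   only in P 0, a relation sum_i c_i q_j ^+ i in P j forces its constant
   coefficient, and after division by q_j all others, to lie in P 0. *)
Lemma prime_chain_indep (A : comPzRingType) (E : fieldType) (r : {rmorphism A -> E})
    (P : nat -> set A) (d : nat) (S : set E) :
    (forall a, r a = 0 <-> P 0%N a) ->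
    (forall i, (i <= d)%N -> prime_ideal (P i)) ->
    (forall i, (i < d)%N -> P i `<` P i.+1) ->
    S `<=` range r ->
    (forall a, generated S (r a) -> P d a -> P 0%N a) ->
  exists ys : seq E, [/\ size ys = d, cl_indep (@alg_closure E) S ys &
    forall y, y \in ys -> range r y].
Proof.
move=> rP; elim: d S => [|d IHd] S Pprime Plt Sr SP; first by exists [::].
have P0sub i : (i <= d.+1)%N -> P 0%N `<=` P i by apply: prime_chain_sub.
have [Pd _] := Plt d (leqnn _); have Pp := Pprime d.+1 (leqnn _).
have Qp := Pprime d (leqnSn _); have [Q0 _ QM _ Qpr] := Qp.
have [q [Pq nPq]] : exists q, P d.+1 q /\ ~ P d q.
  apply: contrapT => noq; case: (Plt d (leqnn _)) => _; apply=> q Pq.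
  by apply: contrapT => nPq; apply: noq; exists q.
have genr : generated S `<=` range r by apply: generated_min Sr; apply: subring_range.
have transc (p : {poly E}) : coefs_in (generated S) p ->
    forall a, r a = p.[r q] -> P d a -> p = 0.
  elim/poly_ind: p => [//|p c IHp] /coefs_in_mulXaddC[gp gc] a ra Pa.
  have [c' _ c'E] := genr _ gc.
  have [a' _ a'E] : range r p.[r q].
    apply: (@horner_coefs_in _ (range r)); first exact: subring_range.
      by move=> i; apply: genr; apply: gp.
    by exists q.
  have P0a : P 0%N (a - (a' * q + c')).
    apply/rP; rewrite rmorphB ra rmorphD rmorphM a'E c'E !hornerE.
    by rewrite subrr.
  have Pc' : P d.+1 c'.
    have -> : c' = a - a' * q - (a - (a' * q + c')).
      by ring.
    apply: prime_idealB => //; last exact: P0sub P0a.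
    by apply: prime_idealB => //; [apply: Pd|case: Pp => _ _ + _ _; apply].
  have c'0 : P 0%N c' by apply: SP; rewrite ?c'E.
  have c0 : c = 0 by rewrite -c'E; apply/rP.
  suff -> : p = 0 by rewrite c0 mul0r addr0.
  apply: (IHp gp a') => //.
  suff /Qpr[] : P d (a' * q) by [].
  have -> : a' * q = a - (a - (a' * q + c')) - c'.
    by ring.
  apply: prime_idealB => //; last exact: P0sub c'0.
  by apply: prime_idealB => //; apply: P0sub P0a.
have [||||ys [szys ind ysr]] := IHd (S `|` [set r q]).
- by move=> i lei; apply: Pprime; apply: leqW.
- by move=> i lti; apply: Plt; apply: leqW.
- by move=> y [/Sr //|->]; exists q.
- move=> a; rewrite adjoinE => -[p gp rap] Pa.
  by apply/rP; rewrite rap (transc p gp a rap Pa) horner0.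
exists (r q :: ys); split=> /=; first by rewrite szys.
- split=> // -[p [p0 gp /rootP pq]]; move/eqP: p0; apply.
  by apply: (transc p gp 0) => //; rewrite rmorph0.
- by move=> y; rewrite inE => /predU1P[->|/ysr //]; exists q.
Qed.

Section UpperBound.
Variables (I : finType) (K : fieldType) (L : I -> fieldType).
Variables (f : forall i, {rmorphism K -> L i}) (o : I).
Variables (m : I -> nat) (X : forall i, 'I_(m i) -> L i).
Hypothesis Xind : forall i, alg_independent (f i) (@X i).
Hypothesis Xmax : forall i, i != o -> forall y : 'I_(m i).+1 -> L i, ~ alg_independent (f i) y.

(** The closure is a subfield, so elements of a single factor suffice. Those of [L o] map into [S];
    those of another factor are algebraic over K(X_i) by maximality of the family, and [r]
    transports their equations. *)
Lemma alg_closure_tensor (E : fieldType) (r : {rmorphism tensor f -> E}) (S : set E) :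
    (forall l, S (r (tensor_in f (l : L o)))) ->
    (forall i (j : 'I_(m i)), S (r (tensor_in f (X j)))) ->
  forall a, alg_closure S (r a).
Proof.
move=> So SX; have [[c1 cB cM] _] := subfield_alg_closure S.
have cs : subring (alg_closure S) by split.
have gs := subring_generated S.
apply: (@tensor_ind _ _ _ f o).
- by rewrite rmorph0; apply: subring0.
- by move=> s t cs' ct; rewrite rmorphD; apply: subringD.
move=> x; rewrite pure_tensor_prod rmorph_prod.
apply: (big_ind (alg_closure S)) => // i _; move: (x i) => l {x}.
have [oi|io] := eqVneq i o; first by subst i; apply: alg_closure_ext.
have [q [q0 ql] qX] := alg_independent_extend (@Xind i) (@Xmax i io (extend (@X i) l)).
pose ti : {rmorphism (L i : comPzRingType) -> tensor f} := @tensor_in I K L f i.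
pose g : {rmorphism L i -> E} := r \o ti.
exists (map_poly g q); split.
- by rewrite map_poly_eq0.
- move=> j; rewrite coef_map /=; have [c ->] := qX j; rewrite -[r _]/(g _) rmorph_mmap.
  apply: mmap_closed => [||||d|k].
  - exact: subring0.
  - by case: gs.
  - by move=> x y; apply: subringD.
  - by case: gs.
  (* Scalars of [K] are moved from factor [i] to factor [o], whose image lies in [S]. *)
  - by apply: sub_generated; rewrite /= (tensor_in_scalar f i o); apply: So.
  - by apply: sub_generated; apply: SX.
- exact: (rmorph_root g ql).
Qed.

(** With [S] the image of [L o] in the residue field of [P 0], [prime_chain_indep] yields d elements
    independent over [S]. They lie in the closure of [S] and the images of the [X i j], so exchange
    bounds d by the number of the latter. *)
Lemma prime_chain_tensor_leq d : has_prime_chain (tensor f) d ->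
  (d <= #|{: {i : I & 'I_(m i)}}|)%N.
Proof.
move=> [P [Pprime Plt]].
have P0d := prime_chain_sub Plt (leqnn d).
have [E [r rP]] := residue_field (Pprime 0%N (leq0n _)).
pose S := range (fun l : L o => r (tensor_in f l)).
have [||ys [szys ind ysr]] := @prime_chain_indep _ E r P d S rP Pprime Plt.
- by move=> _ [l _ <-]; exists (tensor_in f l).
- move=> a gra Pa; have [l _ lE] : S (r a).
    apply: (generated_min _ _ gra) => //.
    pose ti : {rmorphism (L o : comPzRingType) -> tensor f} := @tensor_in I K L f o.
    exact: (subring_range (r \o ti)).
  have Pl : P d (tensor_in f l).
    have -> : tensor_in f l = a - (a - tensor_in f l) by rewrite subKr.
    apply: prime_idealB => //; first exact: Pprime.
    apply: P0d; apply/rP; rewrite rmorphB lE subrr //.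
  (* A nonzero element of the field [L o] would give a unit in [P d]. *)
  have l0 : l = 0.
    apply: contrapT => /eqP l0; have [_ _ PM P1 _] := Pprime d (leqnn _).
    apply: P1; rewrite -(tensor_in1 f o) -(mulVf l0) tensor_inM; exact: PM.
  by apply/rP; rewrite -lE l0 !rmorph0.
pose F (u : {i : I & 'I_(m i)}) := r (tensor_in f (X (tagged u))).
rewrite -szys cardE -(size_map F).
apply: (cl_indep_size (@alg_closure_ext E) (@alg_closure_idem E)
  (@alg_closure_exchange E) ind) => i lti y0.
have [a _ <-] := ysr _ (mem_nth y0 lti).
apply: alg_closure_tensor => [l|j k].
  by apply: sub_adds; exists l.
apply: mem_adds; apply/mapP; exists (Tagged (fun i => 'I_(m i)) k) => //.
by rewrite mem_enum.
Qed.
End UpperBound.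

(** * Lower bound *)

(* The projection onto k along a k-subspace maximal among those avoiding 1. *)
Lemma subfield_retraction (L : fieldType) (k : set L) : subfield k ->
  exists lambda : L -> L,
    [/\ forall a b, lambda (a + b) = lambda a + lambda b,
        forall c a, k c -> lambda (c * a) = c * lambda a,
        forall a, k (lambda a) & lambda 1 = 1].
Proof.
move=> [ks kV]; have [k1 kB kM] := ks; have k0 := subring0 ks.
have kN c := @subringN _ k c ks; have kD c d := @subringD _ k c d ks.
pose good (J : set L) := [/\ J 0, forall x y, J x -> J y -> J (x + y),
  forall c x, k c -> J x -> J (c * x) & ~ J 1].
have [|F [J FJ] Fgood Ftot|W [W0 WD WM W1] Wmax] := @zorn_above L good [set 0].
- split=> [//|_ _ -> ->|c _ _ ->|/eqP]; rewrite /= ?addr0 ?mulr0 //.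
  by rewrite oner_eq0.
- have [J0 _ _ _] := Fgood J FJ; split.
  + by exists J.
  + move=> x y [G FG Gx] [H FH Hy].
    have [_ GD _ _] := Fgood _ FG; have [_ HD _ _] := Fgood _ FH.
    case: (Ftot G H FG FH) => sub; first by exists H => //; apply: HD => //; apply: sub.
    by exists G => //; apply: GD => //; apply: sub.
  + by move=> c x kc [G FG Gx]; have [_ _ GM _] := Fgood _ FG; exists G => //; apply: GM.
  + by move=> [G FG G1]; have [_ _ _] := Fgood _ FG; apply.
have WN x : W x -> W (- x) by rewrite -mulN1r; apply: WM; apply: kN.
have Wk0 c : k c -> W c -> c = 0.
  move=> kc Wc; apply: contrapT => /eqP c0; apply: W1.
  by rewrite -(mulVf c0); apply: WM => //; apply: kV.
(* If [a] is outside [W], then W + ka contains 1 by maximality, say 1 - c * a is in [W]. Here c is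
   nonzero because 1 is not in [W], and dividing by c puts a - c^-1 in [W]. *)
have proj a : exists c, k c /\ W (a - c).
  have [Wa|nWa] := pselect (W a); first by exists 0; rewrite subr0.
  apply: contrapT => noc.
  apply: (Wmax [set w | exists2 c, k c & W (w - c * a)]); first split.
  - by move=> w Ww; exists 0; rewrite // mul0r subr0.
  - by move=> /(_ a) sub; apply: nWa; apply: sub; exists 1; rewrite // mul1r subrr.
  split.
  - by exists 0; rewrite // mul0r subr0.
  - move=> x y [c kc Wc] [d kd Wd]; exists (c + d); first exact: kD.
    by rewrite mulrDl opprD addrACA; apply: WD.
  - move=> e x ke [c kc Wc]; exists (e * c); first exact: kM.
    by rewrite -mulrA -mulrBr; apply: WM.
  - move=> [c kc Wc]; apply: noc.
    have c0 : c != 0 by apply/eqP => c0; apply: W1; rewrite c0 mul0r subr0 in Wc.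
    exists c^-1; split; first exact: kV.
    have -> : a - c^-1 = - c^-1 * (1 - c * a) by rewrite mulNr mulrBr mulr1 mulKf // opprB.
    by apply: (WM) => //; apply/kN/kV.
pose lambda a := projT1 (cid (proj a)).
have lamk a : k (lambda a) by case: (projT2 (cid (proj a))).
have lamW a : W (a - lambda a) by case: (projT2 (cid (proj a))).
have lamE a c : k c -> W (a - c) -> lambda a = c.
  move=> kc Wac; apply/eqP; rewrite -subr_eq0; apply/eqP; apply: Wk0; first exact: kB.
  by rewrite -[lambda a - c](subrKA a) addrC; apply: WD => //; rewrite -opprB; apply: WN.
exists lambda; split=> // [a b|c a kc|].
- by apply: lamE; [exact: kD|rewrite opprD addrACA; apply: WD].
- by apply: lamE; [exact: kM|rewrite -mulrBr; apply: WM].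
- by apply: lamE => //; rewrite subrr.
Qed.

Section Coherent.
Variables (W : idomainType) (spec : nat -> {rmorphism W -> W}).

Lemma coherent0 : coherent spec (fun=> 0).
Proof.
exists (fun=> 0), (fun=> 1) => k.
by rewrite oner_neq0 !rmorph0 mul0r rmorph1.
Qed.

Lemma coherentD e e' : coherent spec e -> coherent spec e' ->
  coherent spec (fun k => e k + e' k).
Proof.
move=> [P [Q PQ]] [P' [Q' PQ']].
exists (fun k => P k * Q' k + P' k * Q k), (fun k => Q k * Q' k) => k.
have [Qk -> <- <-] := PQ k; have [Q'k -> <- <-] := PQ' k.
split; first by rewrite mulf_neq0.
- by rewrite rmorphD !rmorphM addf_div ?tofrac_eq0.
- by rewrite rmorphD !rmorphM.
- by rewrite rmorphM.
Qed.

Lemma coherentM e e' : coherent spec e -> coherent spec e' ->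
  coherent spec (fun k => e k * e' k).
Proof.
move=> [P [Q PQ]] [P' [Q' PQ']].
exists (fun k => P k * P' k), (fun k => Q k * Q' k) => k.
have [Qk -> <- <-] := PQ k; have [Q'k -> <- <-] := PQ' k.
split; first by rewrite mulf_neq0.
- by rewrite !rmorphM mulf_div.
- by rewrite rmorphM.
- by rewrite rmorphM.
Qed.

Lemma coherent_const a : (forall k, spec k a = a) -> coherent spec (fun=> tofrac a).
Proof.
move=> speca; exists (fun=> a), (fun=> 1) => k.
by split; rewrite ?oner_neq0 // rmorph1 // divr1.
Qed.

Lemma coherent_eq0 e k : coherent spec e -> e k = 0 -> e k.+1 = 0.
Proof.
move=> [P [Q PQ]]; have [Qk -> Pk _] := PQ k; have [_ -> _ _] := PQ k.+1.
move/eqP; rewrite mulf_eq0 invr_eq0 !tofrac_eq0 (negbTE Qk) orbF => /eqP P0.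
by rewrite -Pk P0 !rmorph0 mul0r.
Qed.
End Coherent.

Section LowerBound.
Variables (I : finType) (K : fieldType) (L : I -> fieldType).
Variables (f : forall i, {rmorphism K -> L i}) (o : I).
Variables (m : I -> nat) (X : forall i, 'I_(m i) -> L i) (Y : forall i, 'I_(m i) -> L o).
Hypothesis mo : m o = 0%N.
Hypothesis Xind : forall i, alg_independent (f i) (@X i).
Hypothesis Yind : forall i, alg_independent (f o) (@Y i).

(** All the [X i j] are numbered consecutively, so that each step of the chain specializes exactly
    one variable. *)
Let V : finType := {i : I & 'I_(m i)}.
Let s := #|V|.
Let y (v : 'I_s) : L o := Y (tagged (enum_val v)).
Let rho i (j : 'I_(m i)) : 'I_s := enum_rank (Tagged (fun i => 'I_(m i)) j : V).

Lemma has_prime_chain_tensor : has_prime_chain (tensor f) s.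
Proof.
have [W [c [z [spec [ev [specC specz zlt zneq [evC evz]]]]]]] := successive_specialization y.
pose E : fieldType := {fraction W}.
pose g : {rmorphism K -> E} := @tofrac W \o c \o f o.
(* The cast states that the factor at o is the inclusion of L o. *)
pose is_factor i (mu : nat -> L i -> E) :=
  [/\ forall k a b, mu k (a + b) = mu k a + mu k b,
      forall k b a, mu k (f i b * a) = g b * mu k a,
      forall k j a, mu k (X j * a) = tofrac (z k (rho j)) * mu k a,
      (forall k, mu k 1 = 1) /\ (forall a, coherent spec (fun k => mu k a)) &
      forall (e : o = i) k l a, mu k (eq_rect o L l i e * a) = tofrac (c l) * mu k a].
(* At [o] the map is the inclusion of [L o] as constants, for every k. At another index it is the
   retraction onto K(X_i) followed by [sigma k]. *)
have factor i : exists mu, @is_factor i mu.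
  have [oi|io] := eqVneq o i.
    case: i / oi; exists (fun _ a => tofrac (c a)); split.
    - by move=> _ a b; rewrite !rmorphD.
    - by move=> _ b a; rewrite !rmorphM.
    - by move=> k j; exfalso; have := ltn_ord j; rewrite [X in (_ < X)%N]mo.
    - split=> [_|a]; first by rewrite !rmorph1.
      by apply: coherent_const => k; apply: specC.
    - by move=> e _ l a; rewrite (eq_axiomK e) /= !rmorphM.
  have yind : alg_independent (f o) (y \o @rho i).
    rewrite (_ : y \o @rho i = @Y i) //; apply: funext => j /=.
    by rewrite /y /rho enum_rankK.
  have [F [sigma [Fsub [Ff FX] sigmaDM [sigmaf sigmaX] sigmaco]]] :=
    rational_specialization (@Xind i) yind specC specz evC evz.
  have [lambda [lamD lamM lamF lam1]] := subfield_retraction Fsub.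
  exists (fun k a => sigma k (lambda a)); split.
  - by move=> k a b; rewrite lamD; case: (sigmaDM k _ _ (lamF a) (lamF b)).
  - move=> k b a; rewrite lamM //; case: (sigmaDM k _ _ (Ff b) (lamF a)) => _ ->.
    by rewrite sigmaf.
  - move=> k j a; rewrite lamM //; case: (sigmaDM k _ _ (FX j) (lamF a)) => _ ->.
    by rewrite sigmaX.
  - split=> [k|a]; last exact: sigmaco.
    by rewrite lam1 -(rmorph1 (f i)) sigmaf !rmorph1.
  - by move=> e; rewrite e eqxx in io.
have [mu muP] : exists mu, forall i, @is_factor i (mu i).
  by exists (fun i => projT1 (cid (factor i))) => i; exact: projT2 (cid (factor i)).
have muprod k : exists phi : tensor f -> E, {morph phi : a b / a + b} /\
    forall x, phi (pure_tensor f x) = \prod_i mu i k (x i) :> E.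
  apply: (@tensor_prod_map _ _ _ f E g (fun i => mu i k)) => [i a b|i b a].
    by case: (muP i).
  by case: (muP i).
pose phi k := projT1 (cid (muprod k)).
have phiD k : {morph phi k : a b / a + b} by case: (projT2 (cid (muprod k))).
have phiE k x : phi k (pure_tensor f x) = \prod_i mu i k (x i).
  exact: (projT2 (cid (muprod k))).2.
have phi0 k : phi k 0 = 0.
  by apply: (addrI (phi k 0)); rewrite -phiD !addr0.
have phiN k a : phi k (- a) = - phi k a.
  by apply: (addrI (phi k a)); rewrite -phiD !subrr phi0.
(* [phi k] need not be multiplicative, but it commutes with multiplication by an element of one
   factor whenever the map of that factor does. This applies to the variables and to all of
   [L o]. *)
have phi_in i k (a : L i) w b : (forall x, mu i k (a * x) = w * mu i k x) ->
    phi k (tensor_in f a * b) = w * phi k b.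
  move=> muw; elim/(@tensor_ind _ _ _ f o): b => [|b b' IHb IHb'|x].
  - by rewrite mulr0 phi0 mulr0.
  - by rewrite mulrDr !phiD IHb IHb' mulrDr.
  rewrite tensor_in_mul !phiE (bigD1 i) //= [in RHS](bigD1 i) //= dfwith_in muw mulrA.
  by congr (_ * _); apply: eq_bigr => j ji; rewrite dfwith_out // eq_sym.
(* Coherence passes from the factors to products and sums; it will show that each ideal lies in the
   next. *)
have phi_co a : coherent spec (fun k => phi k a).
  elim/(@tensor_ind _ _ _ f o): a => [|a b IHa IHb|x].
  - by rewrite (_ : (fun k => phi k 0) = fun=> 0); [exact: coherent0|exact: funext].
  - rewrite (_ : (fun k => phi k (a + b)) = fun k => phi k a + phi k b).
      exact: coherentD IHa IHb.
    by apply: funext => k; rewrite phiD.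
  rewrite (_ : (fun k => _) = fun k => \prod_i mu i k (x i)); last first.
    by apply: funext => k; rewrite phiE.
  elim: (index_enum I) => [|i r IHr].
    rewrite (_ : (fun k => _) = fun=> tofrac 1).
      by apply: coherent_const => k; rewrite rmorph1.
    by apply: funext => k; rewrite big_nil rmorph1.
  rewrite (_ : (fun k => _) = fun k => mu i k (x i) * \prod_(i <- r) mu i k (x i)).
    by apply: coherentM => //; case: (muP i) => _ _ _ [].
  by apply: funext => k; rewrite big_cons.
pose U (v : 'I_s) : tensor f :=
  tensor_in f (X (tagged (enum_val v))) - tensor_in f (y v).
have phiU k v b : phi k (U v * b) = (tofrac (z k v) - tofrac (c (y v))) * phi k b.
  rewrite mulrBl phiD phiN mulrBl; congr (_ - _); apply: phi_in => x.
    have [_ _ -> _ _] := muP (tag (enum_val v)).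
    congr (tofrac (z k _) * _); rewrite /rho -[RHS]enum_valK; congr enum_rank.
    by case: (enum_val v).
  by have [_ _ _ _ muo] := muP o; have := muo erefl k (y v) x.
(* By [phiU], multiplication by [U v] becomes multiplication by z k v minus the constant y v. This
   is nonzero for k = v, hence regularity, and zero once k exceeds v, hence membership in the next
   ideal. The default 0 only makes the sequence total. *)
apply: (@prime_chain_regular _ s (fun k => [set a | forall b, phi k (a * b) = 0])
   (fun k => if insub k is Some v then U v else 0)).
- move=> k _; split=> /=.
  + by move=> b; rewrite mul0r.
  + by move=> a a' Ia Ia' b; rewrite mulrDl phiD Ia Ia' addr0.
  + by move=> a x Ix b; rewrite (mulrC a) -mulrA Ix.
- move=> /(_ 1); rewrite mulr1 [1]/(pure_tensor f (@family_one I L)) phiE big1.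
    by move/eqP; rewrite oner_eq0.
  by move=> i _; have [_ _ _ [-> _] _] := muP i.
- by move=> k _ a Ia b; apply: (coherent_eq0 (phi_co _)).
- move=> k ks b; rewrite insubT phiU /= zlt ?subrr ?mul0r //.
- move=> k a ks; rewrite insubT => Iua b.
  have /eqP := Iua b; rewrite -mulrA phiU mulf_eq0 subr_eq0 tofrac_eq.
  by rewrite (negbTE (zneq (Ordinal ks))) => /eqP.
Qed.
End LowerBound.

(** * Krull dimension *)

Local Open Scope ereal_scope.

Section NatSup.
Implicit Types (N : set nat) (m : nat).

Lemma supremumE (T : \bar int) (A : set (\bar int)) :
  A !=set0 -> ubound A T -> lbound (ubound A) T -> supremum -oo A = T.
Proof.
move=> /set0P/negbTE A0 ubT lbT; rewrite /supremum A0.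
have supT : supremums A T by split.
exact: (is_subset1_supremums (xgetI _ supT) supT).
Qed.

Lemma nat_sup_max N m : N m -> (forall k, N k -> (k <= m)%N) -> nat_sup N = m%:Z%:E.
Proof.
move=> Nm mmax; apply: supremumE.
- by exists m%:Z%:E, m.
- by move=> _ [k Nk <-]; rewrite lee_fin lez_nat mmax.
- by move=> u; apply; exists m.
Qed.

Lemma nat_sup_infty N : (forall m, exists2 k, N k & (m <= k)%N) -> nat_sup N = +oo.
Proof.
move=> Ninf; apply: supremumE.
- by have [k Nk _] := Ninf 0%N; exists k%:Z%:E, k.
- by move=> *; exact: leey.
- move=> u ubu; case: u ubu => [z|//|] ubu.
    (* An element of [N] above |z| refutes the finite bound [z]. *)
    have [k Nk zk] := Ninf (absz z).+1.
    have : k%:Z%:E <= z%:E by apply: ubu; exists k.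
    rewrite lee_fin => kz; have := le_trans kz (ler_norm z).
    by rewrite -abszE lez_nat leqNgt zk.
  have [k Nk _] := Ninf 0%N.
  by have : k%:Z%:E <= -oo by apply: ubu; exists k.
Qed.

Lemma nat_sup_cases N : N !=set0 ->
  (exists2 m, N m /\ (forall k, N k -> (k <= m)%N) & nat_sup N = m%:Z%:E) \/
  (forall m, exists2 k, N k & (m <= k)%N) /\ nat_sup N = +oo.
Proof.
move=> [k0 Nk0].
have [Ninf|/existsNP[b bN]] := pselect (forall m, exists2 k, N k & (m <= k)%N).
  by right; split=> //; apply: nat_sup_infty.
left; have Nb k : N k -> (k <= b)%N.
  by move=> Nk; rewrite leqNgt; apply/negP => bk; apply: bN; exists k => //; apply: ltnW.
have exN : exists k, `[< N k >] by exists k0; apply/asboolP.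
have Nb' k : `[< N k >] -> (k <= b)%N by move=> /asboolP; apply: Nb.
have [m /asboolP Nm mmax] := ex_maxnP exN Nb'.
have {}mmax k : N k -> (k <= m)%N by move=> /asboolP; apply: mmax.
by exists m => //; apply: nat_sup_max.
Qed.

Lemma le_nat_sup N m : N !=set0 -> m%:Z%:E <= nat_sup N -> exists2 k, N k & (m <= k)%N.
Proof.
case/nat_sup_cases => [[k [Nk _] ->]|[Ninf _] _]; last exact: Ninf.
by rewrite lee_fin lez_nat; exists k.
Qed.
End NatSup.

Definition alg_independent_sizes (K L : fieldType) (f : {rmorphism K -> L}) : set nat :=
  [set m | exists x : 'I_m -> L, alg_independent f x].

Lemma alg_independent_sizes_leq (K L : fieldType) (f : {rmorphism K -> L}) m m' :
  (m' <= m)%N -> alg_independent_sizes f m -> alg_independent_sizes f m'.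
Proof.
move=> lem [x xind]; exists (x \o widen_ord lem).
apply: alg_independent_sub xind => i j /(congr1 val) /= ij; exact: val_inj.
Qed.

Section KrullDimTensor.
Variables (I : finType) (K : fieldType) (L : I -> fieldType).
Variables (f : forall i, {rmorphism K -> L i}) (o : I) (m : I -> nat).

Lemma card_tagged_ord : #|{: {i : I & 'I_(m i)}}| = (\sum_i m i)%N.
Proof.
rewrite card_tagged sumnE big_map big_enum.
by apply: eq_bigr => i _; rewrite card_ord.
Qed.

Lemma tensor_chain_lower : m o = 0%N ->
    (forall i, alg_independent_sizes (f i) (m i)) ->
    (forall i, alg_independent_sizes (f o) (m i)) ->
  has_prime_chain (tensor f) (\sum_i m i).
Proof.
move=> mo Xex Yex; rewrite -card_tagged_ord.
exact: (has_prime_chain_tensor mo (fun i => projT2 (cid (Xex i)))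
  (fun i => projT2 (cid (Yex i)))).
Qed.

Lemma tensor_chain_upper d :
    (forall i, alg_independent_sizes (f i) (m i)) ->
    (forall i, i != o -> ~ alg_independent_sizes (f i) (m i).+1) ->
  has_prime_chain (tensor f) d -> (d <= \sum_i m i)%N.
Proof.
move=> Xex Xmax; rewrite -card_tagged_ord.
apply: (prime_chain_tensor_leq (fun i => projT2 (cid (Xex i))) (o := o)) => i io y yind.
by apply: (Xmax i io); exists y.
Qed.
End KrullDimTensor.

(* The index set {1, ..., n} is shifted to 'I_n, so that p stands for the index
   n - 1 of the statement on paper. *)
Theorem theorem2p4 (n : nat) (n_ge2 : (2 <= n)%N) (K : fieldType)
    (L : 'I_n -> fieldType) (f : forall i, {rmorphism K -> L i})
    (t : 'I_n -> \bar int) (tE : forall i, t i = trdeg (f i))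
    (t_mono : forall i j : 'I_n, (i <= j)%N -> t i <= t j)
    (p : 'I_n) (pE : p = (n - 2)%N :> nat) :
  (t p < +oo -> krull_dim (tensor f) = \sum_(i < n | (i < n.-1)%N) t i) /\
  (~ (t p < +oo) -> krull_dim (tensor f) = +oo).
Proof.
have n1 : (n.-1 < n)%N by rewrite prednK // (leq_trans _ n_ge2).
(* The last field, of largest transcendence degree, is the base M of both bounds. *)
pose o := Ordinal n1.
have ltio (i : 'I_n) : (i < n.-1)%N = (i != o).
  by rewrite -val_eqE /= ltn_neqAle -ltnS prednK ?ltn_ord ?andbT // (leq_trans _ n_ge2).
have tN i : t i = nat_sup (alg_independent_sizes (f i)) by rewrite tE.
have N0 i : alg_independent_sizes (f i) 0%N.
  by exists (fun=> 0%R); apply: alg_independent0.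
have Nne i : alg_independent_sizes (f i) !=set0 by exists 0%N.
have sizes_leq i k : k%:Z%:E <= t i -> alg_independent_sizes (f i) k.
  by rewrite tN => /(le_nat_sup (Nne i))[l Nl kl]; apply: alg_independent_sizes_leq Nl.
split=> [tp_fin|tp_inf].
  (* The value 0 at [o] makes the last field contribute no variables. The other sizes are the
     transcendence degrees, finite because t i <= t p. *)
  have finite_size i : exists k, if i == o then k = 0%N else
      t i = k%:Z%:E /\ ~ alg_independent_sizes (f i) k.+1.
    have [_|io] := eqVneq i o; first by exists 0%N.
    have ti_fin : t i < +oo.
      apply: le_lt_trans tp_fin; apply: t_mono.
      by rewrite pE -ltnS -subSn // subSS subn1 ltio.
    have [[k [_ kmax] tk]|[_ tk]] := nat_sup_cases (Nne i); last by rewrite tN tk in ti_fin.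
    by exists k; rewrite tN tk; split=> // /kmax; rewrite ltnn.
  have [m mP] := choice finite_size.
  have mo : m o = 0%N by have := mP o; rewrite eqxx.
  have tm i : i != o -> t i = (m i)%:Z%:E.
    by move=> io; have := mP i; rewrite (negbTE io) => -[].
  have Nm i : alg_independent_sizes (f i) (m i).
    have [->|io] := eqVneq i o; first by rewrite mo.
    by apply: sizes_leq; rewrite tm.
  have sumE : \sum_(i < n | (i < n.-1)%N) t i = (\sum_i m i)%N%:Z%:E.
    rewrite [in RHS](bigD1 o) //= mo add0n.
    rewrite (big_morph Posz PoszD (erefl 0%:Z)) -sumEFin.
    rewrite (eq_bigl _ _ ltio); apply: eq_bigr => i io; exact: tm.
  rewrite sumE; apply: nat_sup_max => [|d].
    apply: (@tensor_chain_lower _ _ _ _ o) => // i.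
    have [->|io] := eqVneq i o; first by rewrite mo.
    (* Since t i <= t o, the last field contains an independent family as long as the one in
       [L i]. *)
    apply: sizes_leq; rewrite -tm //; apply: t_mono.
    by rewrite -ltnS prednK ?ltn_ord // (leq_trans _ n_ge2).
  apply: (@tensor_chain_upper _ _ _ _ o) => // i io.
  by have := mP i; rewrite (negbTE io) => -[].
have tinf : t p = +oo.
  by apply: contrapT => /eqP; rewrite -ltey => /tp_inf.
have po : p != o.
  by rewrite -ltio pE -[in ltnRHS](subnK n_ge2) addn2.
(* A chain of any length N arises from N variables in [L p] and none elsewhere. The last field has
   room for N independent elements because t p <= t o. *)
apply: nat_sup_infty => N; exists N => //.
pose m (i : 'I_n) := if i == p then N else 0%N.
have -> : N = (\sum_i m i)%N.
  by rewrite (bigD1 p) //= /m eqxx big1 ?addn0 // => i /negbTE ->.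
apply: (@tensor_chain_lower _ _ _ _ o) => [|i|i]; rewrite /m.
- by rewrite eq_sym (negbTE po).
- by case: eqP => // ->; apply: sizes_leq; rewrite tinf leey.
- case: eqP => // _; apply: sizes_leq; apply: le_trans (t_mono p o _).
    by rewrite tinf leey.
  by rewrite /= pE -subn1 leq_sub2l.
Qed.
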